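(* Let $X$ be a complex Banach space, let $T$ be a bounded linear operator on $X$, let $x\in X$ and let $(f(n))$ be a sequence of real numbers satisfying the following condition: there exist an integer $d\geq 0$, real sequences $(g_l(n))_n$ for $0\leq l\leq d$, and real sequences $(\varepsilon_k(n))_n$ for each $k\geq 1$, such that, for all $n,k\geq 1$, $$f(n+k)-f(n)=\sum_{l=0}^{d}g_l(n)k^l+\varepsilon_k(n)$$ and, for each fixed $k\geq 1$, $|\varepsilon_k(n)|\to 0$ as $n\to+\infty$. Then the following are equivalent. (i) $x\in HC(T)$. (ii) $\{e^{if(n)}T^n x;\ n\geq 1\}$ is dense in $X$.
   Context: $HC(T)$ denotes the set of hypercyclic vectors for $T$, i.e. the vectors $x\in X$ such that $\{T^n x;\ n\geq 0\}$ is dense in $X$. *)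

(* Defs.v *)
From mathcomp Require Import all_boot all_order all_algebra.
From mathcomp Require Import complex.
From mathcomp Require Import all_classical all_reals all_analysis.

Set Implicit Arguments.
Unset Strict Implicit.
Unset Printing Implicit Defensive.

Import Order.TTheory GRing.Theory Num.Theory.
Import numFieldNormedType.Exports.

Local Open Scope classical_set_scope.
Local Open Scope ring_scope.
Local Open Scope complex_scope.

(* The norm of a normed space over [R[i]] is valued in [R[i]]; the bound [M] is
   required to be real. *)
Definition bounded_operator (R : realType) (X : normedModType R[i])
    (T : X -> X) : Prop :=
  exists M : R, forall x : X, `|T x| <= M%:C * `|x|.

Definition HC (R : realType) (X : normedModType R[i]) (T : X -> X) : set X :=
  [set x | dense [set iter n T x | n in [set: nat]]].

(* [e^{i theta}], by Euler's formula: the library has no complex exponential. *)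
Definition expi (R : realType) (theta : R) : R[i] :=
  cos theta +i* sin theta.

(* Main.v *)
Require Import Defs.
From HB Require Import structures.
From mathcomp Require Import all_boot all_order all_algebra.
From mathcomp Require Import complex.
From mathcomp Require Import all_classical all_reals all_analysis.
From mathcomp Require Import ring lra zify.

(** If (ii) holds, then the rotated orbit of [x], made of all [c T^n x] with [c] of
    modulus 1, is dense, and by the theorem of Leon-Saavedra and Muller the orbit
    itself is dense ([leon_muller]).

    For the converse, take times [n] with [T^n x] tending to [x] along which the
    phases of [f n] and of the [g l n] converge. Since [f (n + k) - f n] is nearly
    a polynomial in [k], the closure of the set of all [expi (f n) T^n x] contains
    all [expi P(k) T^k x], [k >= 1], for one real polynomial [P]
    ([polynomial_limit_orbit]). So it is enough to treat polynomial phases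
    ([poly_phase_dense]).

    All density results come from one principle ([circle_extension]). Let a system
    [S] commute with an action of the circle, and let [E] be a set of points, each
    of which is in the orbit closure of each other one up to a rotation. Then, for
    points of [E], to be in the orbit closure of each other means to have the same
    image under a continuous circle-valued function [h] on [E] with
    [h (c z) = c ^+ m * h z] for some [m]. The rotation is superfluous as soon as
    [m = 0], so in each case one has to exclude such functions with [m > 0].

    For [T] itself and the multiplication by scalars, [h] would have winding number
    [m] on a loop that can be contracted; this is [leon_muller]. For the product of
    [T] with a rotation of the circle by [zeta], following the argument of [h] along
    [x], [T x], [T^2 x] until the orbit comes back to [x] shows [zeta ^+ m = 1]
    ([linear_phase]); this gives the theorem of Ansari on powers of [T] and the
    joint density of [(T^n x, zeta ^+ n)] when [zeta] is not a root of
    unity.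

    A polynomial phase of degree [D + 1] is a sum of phases of degree [D], so it lives
    on a circle extension of a system carrying the latter. If the leading
    coefficient is an irrational multiple of [2 pi], no [h] with [m > 0] exists: a
    slight irrational change of the phase of degree [D] changes [h] slightly, but in
    the long run rotates the phase of degree [D + 1] arbitrarily, because linear
    phases are independent of the orbit of [x] ([skew_transitive]). A leading
    coefficient that is a rational multiple of [2 pi] is removed by passing to a
    power of [T], which is allowed by Ansari's theorem. *)

Import Order.TTheory GRing.Theory Num.Theory.
Import numFieldNormedType.Exports.

Local Open Scope classical_set_scope.
Local Open Scope ring_scope.
Local Open Scope complex_scope.

Set Implicit Arguments.
Unset Strict Implicit.
Unset Printing Implicit Defensive.

(* Lets the concrete type R[i] be the target of continuous functions. *)
HB.instance Definition _ (R : rcfType) := NormedModule.copy R[i] R[i]^o.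

(** * The unit circle *)

Section Circle.
Variable R : realType.
Implicit Types (t s : R) (c z : R[i]).

Lemma expi0 : expi 0 = 1 :> R[i].
Proof. by rewrite /expi cos0 sin0. Qed.

Lemma expiD t s : expi (t + s) = expi t * expi s.
Proof. by rewrite /expi cosD sinD; simpc; rewrite addrC [X in _ +i* X]addrC. Qed.

Lemma expiN t : expi (- t) * expi t = 1.
Proof. by rewrite -expiD addNr expi0. Qed.

Lemma expi_nat n t : expi (n%:R * t) = expi t ^+ n.
Proof.
elim: n => [|n IH]; first by rewrite mul0r expi0.
by rewrite -natr1 mulrDl mul1r expiD IH exprSr.
Qed.

Lemma norm_expi t : `|expi t| = 1 :> R[i].
Proof. by rewrite normc_def /= cos2Dsin2 sqrtr1. Qed.

Lemma expi2pi : expi (pi *+ 2) = 1 :> R[i].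
Proof. by rewrite /expi cos2pi sin2pi. Qed.

Definition circle : set R[i] := range (@expi R).

Lemma circle_norm c : circle c -> `|c| = 1.
Proof. by case=> t _ <-; exact: norm_expi. Qed.

Lemma circle_neq0 c : circle c -> c != 0.
Proof. by move=> /circle_norm c1; rewrite -normr_gt0 c1. Qed.

Lemma circle1 : circle 1.
Proof. by exists 0 => //; exact: expi0. Qed.

Lemma circleM c c' : circle c -> circle c' -> circle (c * c').
Proof. by move=> [t _ <-] [s _ <-]; exists (t + s) => //; exact: expiD. Qed.

Lemma circleX c n : circle c -> circle (c ^+ n).
Proof. by move=> [t _ <-]; exists (n%:R * t) => //; exact: expi_nat. Qed.

Lemma circleV c : circle c -> circle c^-1.
Proof.
move=> [t _ <-]; exists (- t) => //.
apply: (mulIf (circle_neq0 (imageT _ t))); rewrite expiN mulVf//.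
exact: circle_neq0 (imageT _ t).
Qed.

Lemma real_complex_continuous : continuous (fun t => t%:C : R[i]).
Proof.
move=> t; apply/cvgrPdist_lt => e e0.
have er : e = (complex.Re e)%:C by rewrite RRe_real// gtr0_real.
have Re0 : 0 < complex.Re e by rewrite -ltcR -er.
have /cvgrPdist_lt/(_ _ Re0) := @cvg_id _ (nbhs t).
apply: filterS => s ts.
by rewrite -raddfB /= normc_def /= expr0n addr0 sqrtr_sqr er ltcR.
Qed.

Lemma Im_continuous : continuous (fun z : R[i] => complex.Im z).
Proof.
move=> z; apply/(@cvgrPdist_lt _ _ _ (nbhs z)) => e e0.
have ec0 : 0 < e%:C by rewrite ltcR.
have /cvgrPdist_lt/(_ _ ec0) := @cvg_id _ (nbhs z).
apply: filterS => w zw; rewrite -ltcR.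
have -> : complex.Im z - complex.Im w = - complex.Re ((z - w) * 'i%C).
  by rewrite ReiNIm opprK; case: (z) (w) => ? ? [].
rewrite normrN; apply: le_lt_trans (normc_ge_Re _) _.
by rewrite normrM (normc_def 'i%C) /= expr0n expr1n add0r sqrtr1 mulr1.
Qed.

Lemma continuous_expi : continuous (@expi R).
Proof.
rewrite (_ : @expi R = (fun t => (cos t)%:C + 'i%C * (sin t)%:C)); last first.
  by apply/funext => t; rewrite /expi; simpc.
move=> t; apply: cvgD.
  apply: continuous_comp; first exact: continuous_cos.
  exact: real_complex_continuous.
apply: cvgM; first exact: cvg_cst.
apply: continuous_comp; first exact: continuous_sin.
exact: real_complex_continuous.
Qed.

Lemma expi_eq1 t : 0 < t -> t < pi *+ 2 -> expi t != 1.
Proof.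
move=> t0 t2; apply/eqP => -[] ct st.
have [tpi|] := ltP t pi; first by have := sin_gt0_pi (introT andP (conj t0 tpi)); rewrite st ltxx.
rewrite le_eqVlt => /predU1P[pit|pit].
  by move: ct; rewrite -pit cospi => /eqP; rewrite eq_sym -addr_eq0 -mulr2n pnatr_eq0.
have : 0 < sin (t - pi) by apply: sin_gt0_pi; rewrite subr_gt0 pit ltrBlDr -mulr2n.
by rewrite sinB cospi sinpi st mul0r mulr0 subr0 ltxx.
Qed.

Lemma expi_mod t : exists2 s, 0 <= s <= pi *+ 2 & expi s = expi t.
Proof.
have p0 : 0 < (pi : R) *+ 2 by rewrite mulrn_wgt0 ?pi_gt0// .
have expiz (n : int) : expi (n%:~R * (pi *+ 2)) = 1 :> R[i].
  case: n => n; first by rewrite -pmulrn expi_nat expi2pi expr1n.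
  rewrite NegzE mulrNz mulNr -pmulrn -[RHS](expiN (n.+1%:R * (pi *+ 2))).
  by rewrite expi_nat expi2pi expr1n mulr1.
exists (t - (Num.floor (t / (pi *+ 2)))%:~R * (pi *+ 2)).
  have /andP[f1 f2] := floor_itv (t / (pi *+ 2)).
  rewrite subr_ge0 -ler_pdivlMr// f1/= lerBlDr ltW//.
  move: f2; rewrite ltr_pdivrMr// => /lt_le_trans; apply.
  by rewrite intrD mulrDl mul1r addrC.
by rewrite -[LHS]mulr1 -(expiz (Num.floor (t / (pi *+ 2)))) -expiD subrK.
Qed.

Lemma circleE : circle = @expi R @` `[0, pi *+ 2].
Proof.
apply/seteqP; split => [_ [t _ <-]|_ [t _ <-]]; last by exists t.
by have [s s2 <-] := expi_mod t; exists s => //=; rewrite in_itv.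
Qed.

Lemma compact_circle : compact circle.
Proof.
rewrite circleE; apply: continuous_compact; last exact: segment_compact.
exact/continuous_subspaceT/continuous_expi.
Qed.
End Circle.

Section ClosedSubmonoid.
Variable R : realType.

(** In terms of angles: the set [A] of all [t] with [expi t] in [H] is closed, stable
    under addition, and contains [2 pi] and [- 2 pi]. If it has arbitrarily small
    positive elements it is dense, and [m = 0] describes the whole circle.
    Otherwise it has a least positive element [a], and [2 pi] is a multiple
    [m a], since the first multiple of [a] beyond [2 pi] would exceed it by an
    element of [A] smaller than [a]; then [H] consists of the [m]-th roots of 1. *)
Lemma closed_submonoid_circle (H : set R[i]) : H `<=` @circle R -> closed H ->
  H 1 -> (forall c d, H c -> H d -> H (c * d)) ->
  exists m : nat, forall c, circle c -> (H c <-> c ^+ m = 1).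
Proof.
move=> Hc Hcl H1 HM.
pose A := [set t : R | H (expi t)].
have Acl : closed A by apply: closed_comp => // t _; exact: continuous_expi.
have AD s t : A s -> A t -> A (s + t) by move=> ? ?; rewrite /A /= expiD; exact: HM.
have AX n t : A t -> A (n%:R * t).
  move=> At; elim: n => [|n IH]; first by rewrite mul0r /A /= expi0.
  by rewrite -natr1 mulrDl mul1r; exact: AD.
have p0 : 0 < (pi : R) *+ 2 by rewrite mulrn_wgt0 ?pi_gt0.
have A2 : A (pi *+ 2) by rewrite /A /= expi2pi.
have AN2 : A (- (pi *+ 2)).
  by have := expiN (pi *+ 2 : R); rewrite /A /= expi2pi mulr1 => ->.
have tr (s t : R) : 0 < s -> 0 <= t -> exists n : nat, 0 <= t - n%:R * s < s.
  move=> s0 t0; exists (Num.truncn (t / s)).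
  have /Num.Theory.truncn_itv/andP[h1 h2] : 0 <= t / s by rewrite divr_ge0// ltW.
  rewrite subr_ge0 -ler_pdivlMr// h1/= ltrBlDl -[X in _ + X]mul1r -mulrDl.
  by rewrite natr1 -ltr_pdivrMr.
have pos c : circle c -> exists2 t, 0 <= t <= pi *+ 2 & expi t = c.
  by case=> t _ <-; exact: expi_mod.
have [small|/existsNP[e /not_implyP[e0 /forallNP big]]] :=
    pselect (forall e, 0 < e -> exists t, [/\ A t, 0 < t & t < e]).
  exists 0%N => c /pos[t /andP[t0 _] <-]; split=> // _.
  suff : A t by [].
  apply: Acl => U /nbhs_ballP[e /= e0 eU].
  have [s [As s0 se]] := small e e0.
  have [n /andP[n0 n1]] := tr s t s0 t0.
  exists (n%:R * s); split; first exact: AX.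
  by apply: eU; rewrite /ball /= ger0_norm// (lt_trans n1).
pose B := A `&` [set t | 0 < t].
have Bi : has_inf B.
  split; first by exists (pi *+ 2).
  by exists 0 => t [_ /ltW].
have Be t : B t -> e <= t.
  by move=> [At t0]; rewrite leNgt; apply/negP => te; apply: (big t).
pose a := inf B.
have ae : e <= a by apply: lb_le_inf => //; case: Bi.
have a0 : 0 < a := lt_le_trans e0 ae.
have Bge t : B t -> a <= t by apply: inf_lbound; case: Bi.
have Aa : A a.
  apply: Acl => U /nbhs_ballP[d /= d0 dU].
  have [t Bt ta] := inf_adherent d0 Bi.
  exists t; split; first by case: Bt.
  apply: dU; rewrite /ball /= distrC ger0_norm ?subr_ge0 ?Bge//.
  by rewrite ltrBlDl.
have [m /andP[m0 m1]] := tr a (pi *+ 2) a0 (ltW p0).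
have ma : m%:R * a = pi *+ 2.
  have : a <= (m.+1%:R * a - pi *+ 2).
    apply: Bge; split; first by apply: AD => //; exact: AX.
    by rewrite /= -natr1 mulrDl mul1r subr_gt0 addrC -ltrBlDr.
  by rewrite -natr1 mulrDl mul1r; move: m0 m1; lra.
have AN : A (- a).
  case: m m0 m1 ma => [|m] m0 m1 ma; first by rewrite mul0r in ma; lra.
  have -> : - a = m%:R * a + - (pi *+ 2) by rewrite -ma -natr1; lra.
  by apply: AD => //; exact: AX.
exists m => c /pos[t /andP[t0 t2] <-].
have [j /andP[j0 j1]] := tr a t a0 t0.
have expima : expi (m%:R * a) = 1 :> R[i] by rewrite ma expi2pi.
suff key : A t \/ expi t ^+ m = 1 -> t = j%:R * a.
  split=> [At|tm].
    by rewrite (key (or_introl At)) -expi_nat mulrCA expi_nat expima expr1n.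
  by rewrite (key (or_intror tm)); exact: AX.
case=> [At|tm].
  have : A (t - j%:R * a) by apply: AD => //; rewrite -mulrN; exact: AX.
  move: j0; rewrite le_eqVlt => /predU1P[/esym/eqP|r0 Ar].
    by rewrite subr_eq0 => /eqP.
  by have := Bge _ (conj Ar r0); rewrite leNgt j1.
move: j0; rewrite le_eqVlt => /predU1P[/esym/eqP|r0]; first by rewrite subr_eq0 => /eqP.
have m_gt0 : 0 < m%:R :> R by rewrite -(pmulr_lgt0 _ a0) ma.
have : expi (m%:R * (t - j%:R * a)) != 1 :> R[i].
  by apply: expi_eq1; [rewrite mulr_gt0|rewrite -ma ltr_pM2l].
rewrite mulrBr expiD (expi_nat m t) tm mul1r.
have := expiN (m%:R * (j%:R * a)).
by rewrite [in X in _ * X]mulrCA expi_nat expima expr1n mulr1 => ->; rewrite eqxx.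
Qed.
End ClosedSubmonoid.

(** * Closures and continuity *)

Section ClosureLemmas.

Lemma closure_image (Y Z : topologicalType) (f : Y -> Z) (A : set Y) y :
  {for y, continuous f} -> closure A y -> closure (f @` A) (f y).
Proof. by move=> fy Ay U /fy /Ay [a [Aa Ua]]; exists (f a); split => //; exists a. Qed.

(** Stands for the extraction of a convergent subsequence: a point adherent to the
    values of [s] is completed to a point adherent to the pairs [(s, w)]. *)
Lemma closure_range_lift (I : Type) (Y Z : topologicalType) (s : I -> Y)
    (w : I -> Z) (K : set Z) y :
  compact K -> (forall i, K (w i)) -> closure (range s) y ->
  exists2 k, K k & closure (range (fun i => (s i, w i))) (y, k).
Proof.
move=> /compact_near_coveringP Kc Kw sy; apply: contrapT => nk.
have : \forall y' \near nbhs y, K `<=` (fun k => forall i, ~ (s i = y' /\ w i = k)).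
  apply: Kc => k Kk.
  have /existsNP[U /not_implyP[[[V W] /= [Vy Wk] VWU] nU]] :
      ~ closure (range (fun i => (s i, w i))) (y, k) by move=> c; apply: nk; exists k.
  exists (W, V) => // -[k' y'] /= [Wk' Vy'] i [siy wik]; apply: nU.
  by exists (y', k'); split; [exists i => //; congr pair|exact: VWU].
by move=> /sy[_ [[i _ <-]] /(_ _ (Kw i) i)]; case.
Qed.

Lemma continuous_ident (W : topologicalType) : continuous (fun x : W => x).
Proof. by move=> x; exact: cvg_id. Qed.

Lemma continuous_const (W Y : topologicalType) (y : Y) : continuous (fun _ : W => y).
Proof. by move=> x; exact: cvg_cst. Qed.

Lemma continuous_fst (Y Z : topologicalType) : continuous (fun p : Y * Z => p.1).
Proof. by move=> p; exact: cvg_fst. Qed.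

Lemma continuous_snd (Y Z : topologicalType) : continuous (fun p : Y * Z => p.2).
Proof. by move=> p; exact: cvg_snd. Qed.

Lemma continuous_compose (W Y Z : topologicalType) (f : W -> Y) (g : Y -> Z) :
  continuous f -> continuous g -> continuous (fun x => g (f x)).
Proof. by move=> fc gc x; exact: (@continuous_comp W Y Z f g x (fc x) (gc (f x))). Qed.

Lemma continuous_pair (W Y Z : topologicalType) (f : W -> Y) (g : W -> Z) :
  continuous f -> continuous g -> continuous (fun x => (f x, g x)).
Proof. by move=> fc gc x; exact: (cvg_pair (fc x) (gc x)). Qed.

Lemma continuous_mul (K : numFieldType) (W : topologicalType) (f g : W -> K) :
  continuous f -> continuous g -> continuous (fun x => f x * g x).
Proof. by move=> fc gc x; exact: (continuousM (fc x) (gc x)). Qed.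

Lemma continuous_expn (K : numFieldType) (W : topologicalType) (f : W -> K) n :
  continuous f -> continuous (fun x => f x ^+ n).
Proof.
move=> fc; elim: n => [|n IH]; first by move=> x; exact: cvg_cst.
under eq_fun do rewrite exprS.
exact: continuous_mul.
Qed.

(** A function that is continuous only relatively to [E] is continuous along any
    path that stays in [E]. *)
Lemma within_continuous_comp (W Z Y : topologicalType) (E : set Z) (h : Z -> Y)
    (f : W -> Z) : (forall z, E z -> h z' @[z' --> within E (nbhs z)] --> h z) ->
  continuous f -> (forall w, E (f w)) -> continuous (fun w => h (f w)).
Proof.
move=> hc fc fE w U /(hc _ (fE w)) /= /(fc w) /= fU.
by apply: (@filterS _ (nbhs w) _ _ _ _ fU) => w' /(_ (fE w')).
Qed.

End ClosureLemmas.

(** * Orbit closures and skew products *)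

Section OrbitClosure.
Variables (Z : topologicalType) (S : Z -> Z).

Definition orbit_closure (z : Z) : set Z := closure (range (fun n => iter n S z)).

Lemma orbit_closure_iter n z : orbit_closure z (iter n S z).
Proof. by apply: subset_closure; exists n. Qed.

Lemma continuous_iter n : continuous S -> continuous (iter n S).
Proof.
move=> Sc; elim: n => [|n IH] z; first exact: cvg_id.
by apply: (@continuous_comp _ _ _ (iter n S) S); [exact: IH|exact: Sc].
Qed.

Lemma orbit_closure_trans y z z' : continuous S ->
  orbit_closure z y -> orbit_closure y z' -> orbit_closure z z'.
Proof.
move=> Sc zy yz'; apply: (@closed_closure _ _ z') => U /yz' [_ [[n _ <-]] Un].
exists (iter n S y); split => //.
have /(closure_image (@continuous_iter n Sc y)) := zy.
by apply: closureS => _ [_ [k _ <-] <-]; exists (n + k)%N => //; rewrite iterD.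
Qed.

End OrbitClosure.

Lemma orbit_closure_map (Y Z : topologicalType) (S : Y -> Y) (S' : Z -> Z)
    (f : Y -> Z) y y' :
  continuous f -> (forall y, f (S y) = S' (f y)) ->
  orbit_closure S y y' -> orbit_closure S' (f y) (f y').
Proof.
move=> fc fS /(closure_image (fc y')); apply: closureS => _ [_ [n _ <-] <-].
exists n => //; elim: n => //= n ->; by rewrite fS.
Qed.

Section SkewProduct.
Variables (R : realType) (Z : topologicalType) (S : Z -> Z) (u : Z -> R[i]).

Definition skew (p : Z * R[i]) : Z * R[i] := (S p.1, u p.1 * p.2).

Lemma skew_continuous : continuous S -> continuous u -> continuous skew.
Proof.
move=> Sc uc; apply: continuous_pair.
  exact: continuous_compose (@continuous_fst _ _) Sc.
apply: continuous_mul; last exact: continuous_snd.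
exact: continuous_compose (@continuous_fst _ _) uc.
Qed.

Lemma iter_skew n z c : iter n skew (z, c) =
  (iter n S z, (\prod_(i < n) u (iter i S z)) * c).
Proof.
elim: n => [|n IH]; first by rewrite big_ord0 mul1r.
by rewrite iterS IH /skew /= big_ord_recr /= mulrA [u _ * _]mulrC.
Qed.

(** The fibre coordinate runs through a compact circle, so that a limit in the base
    can be lifted to the skew product. *)
Lemma skew_orbit_closure z z' c : (forall n, circle (u (iter n S z))) -> circle c ->
  orbit_closure S z z' -> exists2 c', circle c' & orbit_closure skew (z, c) (z', c').
Proof.
move=> uT cT zz'.
have [|k kT kc] := closure_range_lift (w := fun n => (\prod_(i < n) u (iter i S z)) * c)
    (@compact_circle R) _ zz'.
  move=> n; apply: circleM => //; elim: n => [|n IH]; first by rewrite big_ord0; exact: circle1.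
  by rewrite big_ord_recr; exact: circleM.
exists k => //; congr (closure _ _): kc; apply/eq_imagel => n _ /=.
by rewrite iter_skew.
Qed.

End SkewProduct.

(** * Extensions by the circle *)

Section CircleExtension.
Variables (R : realType) (Z : topologicalType).

Definition circle_action (rot : R[i] -> Z -> Z) :=
  [/\ continuous (fun p : R[i] * Z => rot p.1 p.2), (forall z, rot 1 z = z)
    & forall c d z, rot c (rot d z) = rot (c * d) z].

Lemma circle_action_continuous_l rot z : circle_action rot ->
  continuous (fun c => rot c z).
Proof.
case=> rotc _ _; apply: (continuous_compose (f := fun c => (c, z))) rotc.
exact: continuous_pair (@continuous_ident _) (@continuous_const _ _ z).
Qed.

Lemma circle_action_continuous_r rot c : circle_action rot -> continuous (rot c).
Proof.
case=> rotc _ _; apply: (continuous_compose (f := fun z => (c, z))) rotc.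
exact: continuous_pair (@continuous_const _ _ c) (@continuous_ident _).
Qed.

(** The rotations [c] such that [rot c z0] lies in the orbit closure of [z0] form a
    closed submonoid [H] of the circle, hence the group [c ^+ m = 1]. For [z] in
    [E], the rotations [c] such that [z] lies in the orbit closure of [rot c z0]
    form a coset of [H], which [c ^+ m =: h z] identifies. As the relation between
    [c] and [z] is closed and the circle is compact, [h] is continuous on [E].
    The point of the lemma: to show that every point of [E] is in the orbit
    closure of every other one, it suffices to exclude [m > 0], and for this one
    can argue on the continuous function [h]. *)
Lemma circle_extension (S : Z -> Z) (rot : R[i] -> Z -> Z) (E : set Z) :
  continuous S -> circle_action rot ->
  (forall c z, S (rot c z) = rot c (S z)) ->
  (forall c z, circle c -> E z -> E (rot c z)) ->
  (forall z z', E z -> E z' ->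
     exists2 c, circle c & orbit_closure S z (rot c z')) ->
  exists (m : nat) (h : Z -> R[i]),
  [/\ forall z, E z -> circle (h z),
      forall z, E z -> h z' @[z' --> within E (nbhs z)] --> h z,
      forall c z, circle c -> E z -> h (rot c z) = c ^+ m * h z
    & forall z z', E z -> E z' -> (orbit_closure S z z' <-> h z = h z')].
Proof.
move=> Sc rotA Srot Erot Edense; have [rotc rot1 rotM] := rotA.
have [[z0 Ez0]|E0] := pselect (E !=set0); last first.
  by exists 0%N, (fun=> 1); split=> [z Ez|z Ez|c z _ Ez|z z' Ez]; case: E0; exists z.
have leads_rot c z z' : orbit_closure S z z' -> orbit_closure S (rot c z) (rot c z').
  apply: orbit_closure_map => [|y]; last by rewrite Srot.
  exact: circle_action_continuous_r.
have rotV c z z' : circle c -> orbit_closure S z (rot c z') ->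
    orbit_closure S (rot c^-1 z) z'.
  move=> cT /(leads_rot c^-1); rewrite rotM mulVf ?rot1//; exact: circle_neq0.
have leads_trans y z z' : orbit_closure S z y -> orbit_closure S y z' ->
    orbit_closure S z z' by exact: orbit_closure_trans.
pose H := [set c | circle c /\ orbit_closure S z0 (rot c z0)].
have [||||m Hm] := @closed_submonoid_circle R H.
- by move=> c [].
- apply: closedI.
    by apply: compact_closed; [exact: norm_hausdorff|exact: compact_circle].
  apply: closed_comp; last exact: closed_closure.
  by move=> c _; exact: circle_action_continuous_l.
- by split; [exact: circle1|rewrite rot1; exact: (@orbit_closure_iter _ S 0%N z0)].
- move=> c d [cT zc] [dT zd]; split; first exact: circleM.
  by apply: leads_trans zc _; rewrite -rotM; exact: leads_rot.
have same c d : circle c -> circle d ->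
    orbit_closure S (rot c z0) (rot d z0) <-> c ^+ m = d ^+ m.
  move=> cT dT; have c0 := circle_neq0 cT.
  have cdT : circle (c^-1 * d) by apply: circleM => //; exact: circleV.
  have -> : (c ^+ m = d ^+ m) <-> ((c^-1 * d) ^+ m = 1).
    rewrite exprMn exprVn; split=> [->|]; first by rewrite mulVf// expf_neq0// circle_neq0.
    by move=> e; rewrite -[LHS]mulr1 -e mulVKf// expf_neq0.
  rewrite -Hm//; split=> [cd|[_ /(leads_rot c)]]; last by rewrite rotM mulVKf.
  by split => //; move: (leads_rot c^-1 _ _ cd); rewrite !rotM mulVf// rot1.
have /choice[k kP] : forall z, exists c : R[i],
    E z -> circle c /\ orbit_closure S (rot c z0) z.
  move=> z; have [Ez|nEz] := pselect (E z); last by exists 1 => /nEz.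
  have [c cT zc] := Edense _ _ Ez0 Ez; exists c^-1 => _.
  by split; [exact: circleV|exact: rotV].
have kT z : E z -> circle (k z) by move=> /kP[].
have lk z : E z -> orbit_closure S (rot (k z) z0) z by move=> /kP[].
have coset z c : E z -> circle c -> orbit_closure S (rot c z0) z -> c ^+ m = k z ^+ m.
  move=> Ez cT cz; have [d dT zd] := Edense _ _ Ez Ez0.
  rewrite ((same c d cT dT).1 (leads_trans _ _ _ cz zd)).
  by rewrite ((same _ d (kT _ Ez) dT).1 (leads_trans _ _ _ (lk _ Ez) zd)).
exists m, (fun z => k z ^+ m); split.
- by move=> z Ez; exact/circleX/kT.
- move=> z Ez W; have : nbhs (k z ^+ m) W -> exists2 V, open_nbhs (k z ^+ m) V & V `<=` W.
    by rewrite nbhsE.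
  move=> /[apply] -[V [Vo Vz] VW].
  pose K := @circle R `&` ~` [set c | V (c ^+ m)].
  have /compact_near_coveringP : compact K.
    apply: (subclosed_compact _ (@compact_circle R)); last by move=> ? [].
    apply: closedI.
      by apply: compact_closed; [exact: norm_hausdorff|exact: compact_circle].
    apply: open_closedC; apply: open_comp => // c _.
    by apply: (@continuous_expn _ _ id) => {}c; exact: cvg_id.
  move=> /(_ Z (nbhs z) (fun z' c => ~ orbit_closure S (rot c z0) z') (nbhs_filter z)) key.
  have : \forall z' \near nbhs z, K `<=` (fun c => ~ orbit_closure S (rot c z0) z').
    apply: key => c [cT nVc].
    have nc : ~ orbit_closure S (rot c z0) z.
      by move=> /(coset _ _ Ez cT) cz; apply: nVc; rewrite /= cz.
    have cV : (fun p : R[i] * Z => rot p.1^-1 p.2) p @[p --> (c, z)] --> rot c^-1 z.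
      have cV1 : p.1^-1 @[p --> (c, z)] --> c^-1.
        have ic : {for c, continuous (fun c : R[i] => c^-1)}.
          exact: (inv_continuous (circle_neq0 cT)).
        exact: (@continuous_comp _ _ _ fst (fun c : R[i] => c^-1) (c, z)
          (@continuous_fst R[i] Z (c, z)) ic).
      have cV2 : {for (c, z), continuous (fun p : R[i] * Z => (p.1^-1, p.2))}.
        exact: (cvg_pair cV1 (@continuous_snd R[i] Z (c, z))).
      exact: (@continuous_comp _ _ _ _ (fun p : R[i] * Z => rot p.1 p.2) (c, z) cV2
        (rotc (c^-1, z))).
    have : nbhs (rot c^-1 z) (~` orbit_closure S z0).
      apply: open_nbhs_nbhs; split; first exact/closed_openC/closed_closure.
      by move/(leads_rot c); rewrite rotM mulfV ?rot1//; exact: circle_neq0.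
    move/cV => -[[U1 U2] /= [U1c U2z] U12].
    exists (U1 `&` [set c | c != 0], U2) => /=.
      split=> //; apply: filterI => //.
      apply: open_nbhs_nbhs; split; last exact: circle_neq0.
      rewrite (_ : [set _ | _] = ~` [set 0]); last first.
        by apply/seteqP; split => d /eqP.
      exact/closed_openC/accessible_closed_set1/hausdorff_accessible/norm_hausdorff.
    move=> [c' z'] /= [[U1c' c'0] U2z'] /(leads_rot c'^-1).
    by rewrite rotM mulVf// rot1; exact: (U12 (c', z')).
  apply: filterS => z' nz' Ez'; apply: VW; apply: contrapT => nV.
  by apply: (nz' (k z')); [split => //; exact: kT|exact: lk].
- move=> c z cT Ez; rewrite -exprMn; apply/esym/coset.
  + exact: Erot.
  + by apply: circleM => //; exact: kT.
  + by rewrite -rotM; exact/leads_rot/lk.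
- move=> z z' Ez Ez'; split=> [zz'|kk].
    by apply: coset => //; [exact: kT|exact: leads_trans (lk _ Ez) zz'].
  have [d dT zd] := Edense _ _ Ez Ez0.
  apply: (leads_trans (rot d z0)) => //; apply: (leads_trans (rot (k z') z0) _ _ _ (lk _ Ez')).
  apply/same => //; first exact: kT.
  by rewrite -kk (same _ d (kT _ Ez) dT).1//; exact: leads_trans (lk _ Ez) zd.
Qed.
End CircleExtension.

(** * Lifting circle-valued maps to angles *)

Section Lifting.
Variable R : realType.

(** By the intermediate value theorem a change of [f] would produce two values of
    [f] whose difference is positive and at most 1, hence not a multiple of
    [2 pi]. *)
Lemma expi_const (f : R -> R) a b : a <= b ->
  {in `[a, b], forall t, {for t, continuous f}} ->
  (forall t, t \in `[a, b] -> expi (f t) = expi (f a)) -> f b = f a.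
Proof.
move=> ab fc fe; apply/eqP; apply: contrapT => /negP fab.
have [d [d0 d1 [s dE]]] : exists d : R, [/\ 0 < d, d <= 1 &
    exists s, Num.min (f a) (f b) <= s <= Num.max (f a) (f b) /\ `|s - f a| = d].
  have [ltab|] := ltP (f a) (f b).
    exists (Num.min 1 (f b - f a)); split; first by rewrite lt_min ltr01 subr_gt0.
      by rewrite ge_min lexx.
    exists (f a + Num.min 1 (f b - f a)).
    have m0 : 0 <= Num.min 1 (f b - f a) by rewrite le_min ler01 subr_ge0 ltW.
    rewrite addrAC subrr add0r ger0_norm// lerDl m0/= -lerBrDl ge_min lexx orbT.
    by [].
  rewrite le_eqVlt (negbTE fab)/= => ltba.
  exists (Num.min 1 (f a - f b)); split; first by rewrite lt_min ltr01 subr_gt0.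
    by rewrite ge_min lexx.
  exists (f a - Num.min 1 (f a - f b)).
  have m0 : 0 <= Num.min 1 (f a - f b) by rewrite le_min ler01 subr_ge0 ltW.
  rewrite addrAC subrr add0r normrN ger0_norm// gerDl oppr_le0 m0 andbT.
  by rewrite lerBrDr -lerBrDl ge_min lexx orbT.
case: dE => sab sd.
have [|t tab ft] := IVT ab _ sab.
  by apply: continuous_in_subspaceT => t; rewrite inE; exact: fc.
have := fe _ tab; rewrite ft => es.
have : expi d = 1 :> R[i].
  rewrite -sd; case: (ler0P (s - f a)) => _; last by rewrite expiD es mulrC expiN.
  by rewrite opprB expiD mulrC -es expiN.
apply/eqP/expi_eq1 => //; apply: le_lt_trans d1 _.
by have := pi_ge2 R; rewrite mulr2n; lra.
Qed.

Definition circle_log (z : R[i]) : R := asin (complex.Im z).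

Lemma circle_log_bound (z : R[i]) : circle z -> `|z - 1| < 1 ->
  0 < complex.Re z /\ -1 < complex.Im z < 1.
Proof.
case=> t _ <- /= h.
have Re0 : 0 < cos t.
  have := le_lt_trans (normc_ge_Re _) h; rewrite /expi /= ltcR.
  by rewrite ltr_distl => /andP[+ _]; lra.
split => //; rewrite -ltr_norml -(@ltr_pXn2r _ 2)// ?nnegrE// expr1n real_normK ?num_real//.
by rewrite sin2cos2 ltrBlDr ltrDl exprn_gt0.
Qed.

Lemma circle_logK z : circle z -> `|z - 1| < 1 -> expi (circle_log z) = z.
Proof.
move=> zT z1; have [Re0 /andP[Im1 Im2]] := circle_log_bound zT z1.
case: zT Re0 Im1 Im2 {z1} => t _ <- /= Re0 Im1 Im2.
have Im : -1 <= sin t <= 1 by rewrite !ltW.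
rewrite /expi /circle_log /= cos_asin// asinK ?in_itv//=.
by rewrite -cos2sin2 sqrtr_sqr ger0_norm// ltW.
Qed.

Lemma continuous_circle_log z : circle z -> `|z - 1| < 1 ->
  {for z, continuous circle_log}.
Proof.
move=> zT z1; have [_ Im1] := circle_log_bound zT z1.
exact: (@continuous_comp _ _ _ (fun z : R[i] => complex.Im z) (@asin R) z
  (@Im_continuous R z) (continuous_asin Im1)).
Qed.

(** Cut [[0, 1]] into [N] steps so small that, uniformly in [s], consecutive values
    of [H] have a quotient at distance less than 1 from 1. The principal
    arguments of these quotients depend continuously on [(t, s)], and their sum
    is the required lift. *)
Lemma circle_homotopy_lift (H : R -> R -> R[i]) :
  continuous (fun p : R * R => H p.1 p.2) -> (forall t s, circle (H t s)) ->
  exists psi : R -> R -> R,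
  [/\ forall t s, t \in `[0, 1] -> s \in `[0, 1] -> H t s = H 0 s * expi (psi t s),
      forall s, psi 0 s = 0
    & forall t s, t \in `[0, 1] -> s \in `[0, 1] ->
        {for (t, s), continuous (fun p : R * R => psi p.1 p.2)}].
Proof.
move=> Hc HT.
have H0 t s : H t s != 0 := circle_neq0 (HT t s).
have [N N0 HN] : exists2 N : nat, (0 < N)%N & forall t t' s, t \in `[0, 1] ->
    s \in `[0, 1] -> `|t' - t| <= N%:R^-1 -> `|H t' s / H t s - 1| < 1.
  have : compact (`[0 : R, 1] `*` `[0 : R, 1]) by apply: compact_setX; exact: segment_compact.
  move/compact_near_coveringP => /(_ nat \oo (fun N p => forall t',
    `|t' - p.1| <= N.+1%:R^-1 -> `|H t' p.2 - H p.1 p.2| < 1) _) key.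
  have [|N _ /(_ N (leqnn N)) /= hN] := key.
    move=> [t s] _.
    have /cvgrPdist_lt/(_ (2^-1)) := Hc (t, s).
    rewrite invr_gt0 ltr0n => /(_ isT) [[U V] /= [Ut Vs] UV].
    have /nbhs_ballP[e /= e0 eU] := Ut.
    have [M Me] : exists M : nat, M.+1%:R^-1 < e / 2.
      have e20 : 0 < e / 2 by rewrite divr_gt0.
      exists (Num.truncn (e / 2)^-1); rewrite invf_plt ?posrE// ?ltr0n//.
      by have /truncn_itv/andP[] : 0 <= (e / 2)^-1 by rewrite invr_ge0 ltW.
    exists ((ball t (e / 2)) `*` V, [set N | (M <= N)%N]) => /=.
      split; first by exists (ball t (e / 2), V) => //=; split => //;
        apply: nbhsx_ballx; rewrite divr_gt0.
      by exists M.
    move=> [[t1 s1] N] /= [[Ut1 Vs1] MN] t' t't1.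
    have Ut1' : U t1 by apply: eU; apply: le_ball Ut1; rewrite ler_pdivrMr// ler_pMr// ler1n.
    have Ut' : U t'.
      apply: eU; rewrite /ball /= -(subrKA t1) [e]splitr; apply: le_lt_trans (ler_normD _ _) _.
      apply: ltrD => //; rewrite distrC; apply: le_lt_trans t't1 _; apply: le_lt_trans Me.
      by rewrite lef_pV2 ?posrE ?ltr0n// ler_nat.
    rewrite -(subrKA (H t s)) (splitr 1); apply: le_lt_trans (ler_normD _ _) _.
    by rewrite ltrD// ?div1r; [rewrite distrC; exact: (UV (t', s1))|exact: (UV (t1, s1))].
  exists N.+1 => // t t' s t01 s01 tt'.
  have := hN (t, s) (conj t01 s01) t' tt' => /=.
  rewrite -[X in X / _](subrK (H t s)) mulrDl divff// addrK normrM normfV.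
  by rewrite (circle_norm (HT t s)) invr1 mulr1.
pose g j t := t * (j%:R / N%:R) : R.
pose psi t s := \sum_(j < N) circle_log (H (g j.+1 t) s / H (g j t) s).
have NR : 0 < N%:R :> R by rewrite ltr0n.
have g01 j t : (j <= N)%N -> t \in `[0, 1] -> g j t \in `[0, 1].
  move=> jN; rewrite !in_itv /= => /andP[t0 t1].
  have j0 : 0 <= j%:R / N%:R :> R by rewrite divr_ge0.
  rewrite mulr_ge0// mulr_ile1//.
  by rewrite ler_pdivrMr// mul1r ler_nat.
have step t s j : (j < N)%N -> t \in `[0, 1] -> s \in `[0, 1] ->
    `|H (g j.+1 t) s / H (g j t) s - 1| < 1.
  move=> jN t01 s01; apply: HN => //; first by apply: g01 => //; exact: ltnW.
  rewrite /g -mulrBr -mulrBl -natr1 addrAC subrr add0r mul1r.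
  move: t01; rewrite in_itv /= => /andP[t0 t1].
  by rewrite normrM !ger0_norm// ?invr_ge0// ler_piMl// invr_ge0.
have ratioT t s j : circle (H (g j.+1 t) s / H (g j t) s).
  by apply: circleM => //; exact: circleV.
exists psi; split.
- move=> t s t01 s01.
  have aux n : (n <= N)%N -> H (g n t) s = H 0 s *
      expi (\sum_(j < n) circle_log (H (g j.+1 t) s / H (g j t) s)).
    elim: n => [_|n IH nN]; first by rewrite big_ord0 expi0 mulr1 /g mul0r mulr0.
    rewrite big_ord_recr /= expiD mulrA -IH; last exact: ltnW.
    by rewrite circle_logK//; [rewrite mulrC divfK|exact: step].
  by rewrite -aux// /g divff ?mulr1// gt_eqF.
- move=> s; rewrite /psi big1// => j _; rewrite /g !mul0r divff// /circle_log /=.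
  by rewrite -[X in asin X]sin0 sinK// in_itv /= oppr_le0 andbb divr_ge0// pi_ge0.
- move=> t s t01 s01; rewrite /psi.
  have Hg j : continuous (fun p : R * R => H (g j p.1) p.2).
    apply: (continuous_compose (f := fun p : R * R => (g j p.1, p.2))) Hc.
    apply: continuous_pair; last exact: continuous_snd.
    by apply: continuous_mul; [exact: continuous_fst|exact: continuous_const].
  apply: cvg_big => [|j _]; first exact: add_continuous.
  have : {for (t, s), continuous (fun p : R * R => H (g j.+1 p.1) p.2 / H (g j p.1) p.2)}.
    by apply: cvgM; [exact: Hg|apply: cvgV; [exact: H0|exact: Hg]].
  move=> /(@continuous_comp _ _ _ _ circle_log (t, s)); apply.
  by apply: continuous_circle_log => //=; apply: step.
Qed.

End Lifting.

Section LiftTools.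
Variable R : realType.

Lemma expiB (s t : R) : expi (s - t) = expi s / expi t.
Proof.
have t0 := circle_neq0 (imageT (@expi R) t).
by apply: (mulIf t0); rewrite -expiD subrK divfK.
Qed.

Lemma in01 (t : R) : 0 <= t -> t <= 1 -> t \in `[0, 1].
Proof. by rewrite in_itv /= => -> ->. Qed.

(** Two lifts of the same path, up to a constant factor, differ by a constant. *)
Lemma expi_lift_unique (f g : R -> R) (c : R[i]) :
  {in `[0, 1], forall t, {for t, continuous f}} ->
  {in `[0, 1], forall t, {for t, continuous g}} ->
  (forall t, t \in `[0, 1] -> expi (f t) = c * expi (g t)) ->
  f 1 - g 1 = f 0 - g 0.
Proof.
move=> fc gc fg.
apply: (@expi_const R (fun t => f t - g t) 0 1 ler01) => t t01.
  exact: (continuousB (fc t t01) (gc t t01)).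
have e0 s : expi (g s) != 0 by exact: circle_neq0 (imageT (@expi R) (g s)).
by rewrite !expiB (fg _ t01) (fg 0 (in01 (lexx _) ler01)) !mulfK.
Qed.

Lemma lift_slice (psi : R -> R -> R) s :
  s \in `[0, 1] ->
  (forall t s, t \in `[0, 1] -> s \in `[0, 1] ->
        {for (t, s), continuous (fun p : R * R => psi p.1 p.2)}) ->
  {in `[0, 1], forall t, {for t, continuous (fun t => psi t s)}} /\
  {in `[0, 1], forall t, {for t, continuous (psi s)}}.
Proof.
move=> s01 psic; split=> t t01.
  have c : continuous (fun t : R => (t, s)).
    by apply: continuous_pair; [exact: continuous_ident|exact: continuous_const].
  exact: (@continuous_comp _ _ _ _ (fun p : R * R => psi p.1 p.2) t (c t) (psic t s t01 s01)).
have c : continuous (fun t : R => (s, t)).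
  by apply: continuous_pair; [exact: continuous_const|exact: continuous_ident].
exact: (@continuous_comp _ _ _ _ (fun p : R * R => psi p.1 p.2) t (c t) (psic s t s01 t01)).
Qed.

End LiftTools.

(** * Hypercyclic vectors and polynomials of the operator *)

Section Operators.
Variables (R : realType) (X : normedModType R[i]).

Lemma closure_normP (A : set X) (y : X) :
  closure A y <-> forall e : R[i], 0 < e -> exists2 a, A a & `|y - a| < e.
Proof.
split=> [Ay e e0|h U /nbhs_ballP[e e0 eU]].
  by have [a [Aa ya]] := Ay _ (nbhsx_ballx y e e0); exists a; rewrite // -ball_normE in ya *.
by have [a Aa ya] := h e e0; exists a; split => //; apply: eU; rewrite -ball_normE.
Qed.

(** Linearity is a property of maps here, since it is needed for the iterates of an
    operator as well. *)
Lemma linear_iter (T : X -> X) n : linear T -> linear (iter n T).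
Proof. by move=> Tl; elim: n => [|n IH] a u v //=; rewrite IH Tl. Qed.

Section LinearMaps.
Variable T : X -> X.
Hypothesis Tl : linear T.

Lemma lin0 : T 0 = 0.
Proof. by have := Tl (-1) 0 0; rewrite scaler0 addr0 scaleN1r addNr. Qed.
Lemma linZ a u : T (a *: u) = a *: T u.
Proof. by have := Tl a u 0; rewrite lin0 !addr0. Qed.
Lemma linD u v : T (u + v) = T u + T v.
Proof. by have := Tl 1 u v; rewrite !scale1r. Qed.
Lemma linB u v : T (u - v) = T u - T v.
Proof. by rewrite -scaleN1r linD linZ scaleN1r. Qed.
Lemma lin_sum (I : Type) (r : seq I) (F : I -> X) :
  T (\sum_(i <- r) F i) = \sum_(i <- r) T (F i).
Proof. by elim: r => [|i r IH]; rewrite ?big_nil ?lin0// !big_cons linD IH. Qed.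
End LinearMaps.

Lemma circle_action_scale : circle_action (fun (c : R[i]) (y : X) => c *: y).
Proof.
split; [exact: scale_continuous|exact: scale1r|].
by move=> c d z; rewrite scalerA.
Qed.

Lemma continuous_scale (W : topologicalType) (c : W -> R[i]) (f : W -> X) :
  continuous c -> continuous f -> continuous (fun w => c w *: f w).
Proof. by move=> cc fc w; exact: (continuousZ (cc w) (fc w)). Qed.

Lemma continuous_add (W : topologicalType) (f g : W -> X) :
  continuous f -> continuous g -> continuous (fun w => f w + g w).
Proof. by move=> fc gc w; exact: (continuousD (fc w) (gc w)). Qed.

Definition hypercyclic (T : X -> X) (x : X) := forall y, orbit_closure T x y.

Definition circle_hypercyclic (T : X -> X) (x : X) := forall y,
  closure (range (fun p : R * nat => expi p.1 *: iter p.2 T x)) y.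

Lemma hypercyclic_circle T x : hypercyclic T x -> circle_hypercyclic T x.
Proof.
move=> xh y; have := xh y; apply: closureS => _ [n _ <-].
by exists (0, n) => //=; rewrite expi0 scale1r.
Qed.

(** If [c T^n x] is close to [y], then [T^n x] is close to [c^-1 y]; by compactness the
    rotations [c^-1] accumulate at a point of the circle. *)
Lemma circle_hypercyclic_orbit T x y : circle_hypercyclic T x ->
  exists2 c : R[i], circle c & orbit_closure T x (c *: y).
Proof.
move=> /(_ y) xy.
have [p|c cT cc] := closure_range_lift (w := fun p : R * nat => expi (- p.1))
    (@compact_circle R) _ xy; first by exists (- p.1).
exists c => //.
have fc : continuous (fun q : X * R[i] => q.2 *: q.1).
  exact: (continuous_scale (@continuous_snd _ _) (@continuous_fst _ _)).
have /= := closure_image (fc (y, c)) cc.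
apply: closureS => _ [_ [[t n] _ <-] <-] /=; exists n => //.
by rewrite scalerA expiN scale1r.
Qed.

End Operators.

Section PolynomialAction.
Variables (R : realType) (X : normedModType R[i]) (T : X -> X).
Hypotheses (Tl : linear T) (Tc : continuous T).

(** Modulo the range [Z] of [T - lam], the vector [iter n T x] is [lam ^+ n *: x]. If
    [`|lam| <= 1], these vectors are bounded modulo [Z], and approximating large
    multiples of [v] by the rotated orbit shows that [v] is adherent to [Z]. If
    [`|lam| > 1], approximating 0 by the rotated orbit shows that [x] is adherent
    to [Z], and then so is the whole rotated orbit. *)
Lemma dense_range_sub (x : X) (lam : R[i]) : circle_hypercyclic T x ->
  forall v : X, closure (range (fun y => T y - lam *: y)) v.
Proof.
move=> xh v.
pose Z : set X := range (fun y => T y - lam *: y).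
have ZD y z : Z y -> Z z -> Z (y + z).
  move=> [a _ <-] [b _ <-]; exists (a + b) => //.
  by rewrite linD// scalerDr opprD addrACA.
have ZZ c y : Z y -> Z (c *: y).
  move=> [a _ <-]; exists (c *: a) => //.
  by rewrite linZ// scalerBr !scalerA mulrC.
have Zn n : Z (iter n T x - lam ^+ n *: x).
  elim: n => [|n IH]; first by exists 0 => //; rewrite lin0// scaler0 !subr0 expr0 scale1r subrr.
  have -> : iter n.+1 T x - lam ^+ n.+1 *: x =
      (T (iter n T x) - lam *: iter n T x) + lam *: (iter n T x - lam ^+ n *: x).
    by rewrite scalerBr scalerA -exprS addrA subrK.
  by apply: ZD; [exists (iter n T x)|exact: ZZ].
have near_orbit y e : 0 < e -> exists2 c : R[i], `|c| = 1 & exists n, `|y - c *: iter n T x| < e.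
  move=> e0; have /closure_normP/(_ e e0)[_ [[t n] _ <-] /= h] := xh y.
  by exists (expi t); [exact: norm_expi|exists n].
apply/closure_normP => e e0.
have [lam1|lam1] := real_leP (normr_real lam) (@real1 R[i]).
  (* M *: v is approximated with error 1, and dividing by M > b makes the error, plus
     the bounded part modulo Z, smaller than e. *)
  pose b := (1 + `|x|) / e.
  have b0 : 0 <= b by rewrite divr_ge0 ?addr_ge0// ltW.
  have [M M0 Mb] : exists2 M : nat, (0 < M)%N & b < M%:R.
    exists (Num.truncn (complex.Re b)).+1 => //.
    have bR : b = (complex.Re b)%:C by rewrite RRe_real// ger0_real.
    rewrite bR -[_%:R](rmorph_nat (real_complex R)) ltcR.
    by have /truncn_itv/andP[] : 0 <= complex.Re b by rewrite bR lecR in b0.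
  have M0' : 0 < M%:R :> R[i] by rewrite ltr0n.
  have [c c1 [n hn]] := near_orbit (M%:R *: v) 1 ltr01.
  exists (M%:R^-1 *: (c *: (iter n T x - lam ^+ n *: x))); first exact/ZZ/ZZ.
  rewrite -(ltr_pM2l M0') -{1}(@ger0_norm _ M%:R)// -normrZ.
  rewrite scalerBr scalerA mulfV ?gt_eqF// scale1r.
  move: Mb; rewrite /b ltr_pdivrMr//; apply: le_lt_trans.
  rewrite scalerBr opprB addrCA [_ + (_ - _)]addrC; apply: le_trans (ler_normD _ _) _.
  rewrite lerD ?(ltW hn)// !normrZ c1 mul1r normrX ler_piMl//.
  exact: exprn_ile1.
have lam0 : 0 < `|lam| := lt_trans ltr01 lam1.
have xZ d : 0 < d -> exists2 z, Z z & `|x - z| < d.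
  move=> d0; have [c c1 [n]] := near_orbit 0 d d0; rewrite sub0r normrN normrZ c1 mul1r => hn.
  have l0 : lam ^+ n != 0 by rewrite expf_neq0// -normr_gt0.
  exists (- (lam ^+ n)^-1 *: (iter n T x - lam ^+ n *: x)); first exact: ZZ.
  rewrite scaleNr opprK scalerBr scalerA mulVf// scale1r addrC subrK.
  rewrite normrZ normfV normrX; apply: le_lt_trans hn.
  rewrite ler_piMl// invf_le1 ?exprn_gt0//; apply: exprn_ege1; exact: ltW.
have e20 : 0 < e / 2 by rewrite divr_gt0.
have [c c1 [n hn]] := near_orbit v _ e20.
have l0 : 0 < `|lam| ^+ n by rewrite exprn_gt0.
have [z Zz hz] := xZ (e / 2 / `|lam| ^+ n) (divr_gt0 e20 l0).
exists (c *: (iter n T x - lam ^+ n *: x) + c *: (lam ^+ n *: z)).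
  by apply: ZD; [exact: ZZ|exact/ZZ/ZZ].
have -> : v - (c *: (iter n T x - lam ^+ n *: x) + c *: (lam ^+ n *: z)) =
    (v - c *: iter n T x) + c *: (lam ^+ n *: (x - z)).
  by rewrite !scalerBr opprD opprB -!addrA; congr (_ + _); rewrite addrCA.
rewrite (splitr e); apply: le_lt_trans (ler_normD _ _) _; apply: ltrD => //.
by rewrite !normrZ c1 mul1r normrX mulrC -ltr_pdivlMr.
Qed.

(** [A] sends the rotated orbit of [x] to that of [A x]. *)
Lemma circle_hypercyclic_image (A : X -> X) x : linear A -> continuous A ->
  (forall y, A (T y) = T (A y)) -> (forall y, closure (range A) y) ->
  circle_hypercyclic T x -> circle_hypercyclic T (A x).
Proof.
move=> Al Ac AT Ad xh y.
have An n z : A (iter n T z) = iter n T (A z).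
  by elim: n => //= n IH; rewrite AT IH.
have sub : range A `<=` closure (range (fun p : R * nat => expi p.1 *: iter p.2 T (A x))).
  move=> _ [z _ <-]; have := closure_image (Ac z) (xh z).
  by apply: closureS => _ [_ [[t n] _ <-] <-] /=; exists (t, n); rewrite //= linZ// An.
by apply: closed_closure; exact: (closureS sub) (Ad y).
Qed.

(** This is [q(T) y]. *)
Definition poly_act (q : {poly R[i]}) (y : X) : X :=
  \sum_(i < size q) q`_i *: iter i T y.

Lemma poly_act_widen n (q : {poly R[i]}) y : (size q <= n)%N ->
  poly_act q y = \sum_(i < n) q`_i *: iter i T y.
Proof.
move=> qn; rewrite /poly_act (big_ord_widen n (fun i => q`_i *: iter i T y))//.
rewrite big_mkcond /=; apply: eq_bigr => i _; case: ltnP => // iq.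
by rewrite nth_default// scale0r.
Qed.

Lemma poly_actD (p q : {poly R[i]}) y : poly_act (p + q) y = poly_act p y + poly_act q y.
Proof.
pose n := maxn (size p) (size q).
rewrite !(@poly_act_widen n) ?leq_maxl ?leq_maxr ?size_polyD// -big_split /=.
by apply: eq_bigr => i _; rewrite coefD scalerDl.
Qed.

Lemma poly_actZ a (q : {poly R[i]}) y : poly_act (a *: q) y = a *: poly_act q y.
Proof.
rewrite (@poly_act_widen (size q)) ?size_scale_leq// scaler_sumr.
by apply: eq_bigr => i _; rewrite coefZ scalerA.
Qed.

Lemma poly_actXn n y : poly_act 'X^n y = iter n T y.
Proof.
rewrite /poly_act size_polyXn big_ord_recr /= big1 => [|i _].
  by rewrite add0r coefXn eqxx scale1r.
by rewrite coefXn (ltn_eqF (ltn_ord i)) scale0r.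
Qed.

Lemma poly_act1 y : poly_act 1 y = y.
Proof. exact: (poly_actXn 0). Qed.

Lemma poly_actMX (q : {poly R[i]}) y : poly_act ('X * q) y = T (poly_act q y).
Proof.
rewrite (@poly_act_widen (size q).+1); last first.
  by rewrite mulrC; have [->|q0] := eqVneq q 0; rewrite ?mul0r ?size_poly0// size_mulX.
rewrite big_ord_recl coefXM eqxx scale0r add0r (lin_sum Tl).
by apply: eq_bigr => i _; rewrite coefXM /= (linZ Tl).
Qed.

(** The field is algebraically closed, so [q(T)] is a product of factors [T - z] and
    of a scalar, all of which have dense range. *)
Lemma poly_act_circle_hypercyclic (q : {poly R[i]}) x : q != 0 ->
  circle_hypercyclic T x -> circle_hypercyclic T (poly_act q x).
Proof.
have [r ->] := closed_field_poly_normal q.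
rewrite scaler_eq0 negb_or => /andP[c0 _] xh; set c := lead_coef q in c0 *.
rewrite poly_actZ.
have scale_cont (a : R[i]) : continuous (fun y : X => a *: y) by exact: scaler_continuous.
apply: circle_hypercyclic_image => [a u v|//|y|y|].
- by rewrite scalerDr !scalerA mulrC.
- by rewrite linZ.
- by apply: subset_closure; exists (c^-1 *: y); rewrite // scalerA mulfV ?scale1r.
elim: r => [|z r IH]; first by rewrite big_nil poly_act1.
rewrite big_cons mulrBl mul_polyC -scaleNr poly_actD poly_actMX poly_actZ scaleNr.
set p := \prod_(_ <- _) _ in IH *.
apply: (@circle_hypercyclic_image (fun y => T y - z *: y)) => [a u v||y|y|//].
- by rewrite Tl scalerDr opprD scalerBr !scalerA [z * a]mulrC addrACA.
- under eq_fun do rewrite -scaleNr.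
  exact: continuous_add Tc (scale_cont (- z)).
- by rewrite /= (linB Tl) (linZ Tl).
- exact: (dense_range_sub z xh).
Qed.

End PolynomialAction.

(** * Removing rotations *)

Lemma affine_poly_eq0 (K : nzRingType) (a b : K) : a *: 'X + b *: 1 = 0 -> a = 0 /\ b = 0.
Proof.
move=> q0; split.
  have := congr1 (fun q : {poly K} => q`_1) q0.
  by rewrite coefD !coefZ coefX coef1 mulr1 mulr0 addr0 coef0.
have := congr1 (fun q : {poly K} => q`_0) q0.
by rewrite coefD !coefZ coefX coef1 mulr1 mulr0 add0r coef0.
Qed.

Section LeonMuller.
Variables (R : realType) (X : normedModType R[i]) (T : X -> X).
Hypotheses (Tl : linear T) (Tc : continuous T).

(** The nonzero polynomials of [T], applied to [x], form a set [E] of vectors whose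
    rotated orbits are dense. By [circle_extension] it is enough to prove [m = 0].
    On the loop [c |-> c *: x] the function [h] has winding number [m]; but this
    loop contracts in [E] to the point [T x] along the segments
    [(1 - t) T x + t c x], which are given by nonzero polynomials of degree at
    most 1. *)
Lemma leon_muller x : circle_hypercyclic T x -> hypercyclic T x.
Proof.
move=> xh.
pose E := [set poly_act T q x | q in [set q : {poly R[i]} | q != 0]].
have Eh y : E y -> circle_hypercyclic T y.
  by move=> [q q0 <-]; exact: poly_act_circle_hypercyclic.
have Ex : E x by exists 1; [exact: oner_neq0|exact: poly_act1].
have Escale c y : circle c -> E y -> E (c *: y).
  move=> cT [q /= q0 <-]; exists (c *: q); last exact: poly_actZ.
  by rewrite /= scaler_eq0 negb_or (circle_neq0 cT).
have ext := @circle_extension R X T (fun c y => c *: y) E.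
have ext1 := ext Tc.
have ext2 := ext1 (circle_action_scale X).
have [c z|c z|z z' Ez _|m [h [hT hc hrot hlead]]] := ext2.
- by rewrite (linZ Tl).
- exact: Escale.
- exact: circle_hypercyclic_orbit (Eh _ Ez).
pose V (t s : R) := (1 - t)%:C *: T x + (t%:C * expi (pi *+ 2 * s)) *: x.
have EV t s : E (V t s).
  exists ((1 - t)%:C *: 'X + (t%:C * expi (pi *+ 2 * s)) *: 1).
    apply/eqP => /affine_poly_eq0[/complexI/eqP t1].
    move=> /eqP; rewrite mulf_eq0 (negbTE (circle_neq0 (imageT (@expi R) _))) orbF.
    by move=> /eqP/complexI t0; move: t1; rewrite t0 subr0 oner_eq0.
  by rewrite poly_actD !poly_actZ poly_act1 (poly_actXn _ 1).
have Vc : continuous (fun p : R * R => V p.1 p.2).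
  apply: continuous_add.
    apply: continuous_scale; last exact: continuous_const.
    apply: continuous_compose (@real_complex_continuous R).
    by move=> p; apply: cvgB; [exact: cvg_cst|exact: cvg_fst].
  apply: continuous_scale; last exact: continuous_const.
  apply: continuous_mul.
    exact: continuous_compose (@continuous_fst _ _) (@real_complex_continuous R).
  apply: continuous_compose (@continuous_expi R).
  by apply: continuous_mul; [exact: continuous_const|exact: continuous_snd].
have [||psi [psiH psi0 psic]] := @circle_homotopy_lift R (fun t s => h (V t s)).
- by apply: (within_continuous_comp hc Vc) => -[t s]; exact: EV.
- by move=> t s; exact/hT/EV.
have hTx0 s : h (V 0 s) = h (T x).
  by rewrite /V subr0 scale1r mul0r scale0r addr0.
have hTx_neq0 : h (T x) != 0 by rewrite -(hTx0 0); exact/circle_neq0/hT/EV.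
have psiE t s : t \in `[0, 1] -> s \in `[0, 1] -> expi (psi t s) = h (V t s) / h (T x).
  by move=> t01 s01; rewrite psiH// hTx0 mulrAC divff// mul1r.
have i0 : (0 : R) \in `[0, 1] := in01 (lexx _) ler01.
have i1 : (1 : R) \in `[0, 1] := in01 ler01 (lexx _).
have per : psi 1 1 = psi 1 0.
  apply/eqP; rewrite -subr_eq0; apply/eqP.
  rewrite (@expi_lift_unique _ (fun t => psi t 1) (fun t => psi t 0) 1).
  - by rewrite !psi0 subrr.
  - exact: (lift_slice i1 psic).1.
  - exact: (lift_slice i0 psic).1.
  - by move=> t t01; rewrite mul1r !psiE// /V !mulr1 mulr0 expi2pi expi0.
have m0 : m = 0%N.
  have : psi 1 1 - m%:R * (pi *+ 2 * 1) = psi 1 0 - m%:R * (pi *+ 2 * 0).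
    apply: (@expi_lift_unique _ (psi 1) (fun s => m%:R * (pi *+ 2 * s)) (h x / h (T x))).
    - exact: (lift_slice i1 psic).2.
    - move=> s _; apply: cvgM; first exact: cvg_cst.
      by apply: cvgM; [exact: cvg_cst|exact: cvg_id].
    - move=> s s01; rewrite psiE// /V subrr scale0r add0r mul1r expi_nat.
      by rewrite (hrot _ _ (imageT (@expi R) _) Ex) -mulrA mulrC.
  rewrite per !mulr0 subr0 mulr1 => /eqP; rewrite -subr_eq0 addrAC subrr add0r oppr_eq0.
  by rewrite mulf_eq0 pnatr_eq0 mulrn_eq0 /= (gt_eqF (pi_gt0 R)) orbF => /eqP.
have lead y c : E y -> circle c -> orbit_closure T y (c *: y).
  move=> Ey cT; apply/hlead => //; first exact: Escale.
  by rewrite hrot// m0 expr0 mul1r.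
move=> y; apply: (@closed_closure _ _ y); have := xh y; apply: closureS.
move=> _ [[t n] _ <-] /=.
have tT : circle (expi t) by exists t.
have -> : expi t *: iter n T x = iter n T (expi t *: x).
  by rewrite (linZ (linear_iter n Tl)).
exact: (orbit_closure_trans Tc (lead x _ Ex tT) (@orbit_closure_iter _ T n _)).
Qed.
End LeonMuller.

(** * Linear phases *)

Section RotateSecond.
Variables (R : realType) (Z : topologicalType).

Definition rotate_snd (c : R[i]) (p : Z * R[i]) : Z * R[i] := (p.1, c * p.2).

Lemma circle_action_rotate_snd : circle_action rotate_snd.
Proof.
split.
- apply: continuous_pair.
    by apply: (continuous_compose (@continuous_snd _ _)); exact: continuous_fst.
  apply: continuous_mul; first exact: continuous_fst.
  by apply: (continuous_compose (@continuous_snd _ _)); exact: continuous_snd.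
- by case=> z c; rewrite /rotate_snd mul1r.
- by move=> c d [z e]; rewrite /rotate_snd /= mulrA.
Qed.

Lemma skew_rotate_snd (S : Z -> Z) u c p :
  skew S u (rotate_snd c p) = rotate_snd c (skew S u p).
Proof. by rewrite /skew /rotate_snd /= mulrCA. Qed.

Lemma rotate_orbit_closure (S : Z -> Z) (u : Z -> R[i]) (c d e : R[i]) z z' :
  orbit_closure (skew S u) (z, c) (z', d) ->
  orbit_closure (skew S u) (z, e * c) (z', e * d).
Proof.
apply: (@orbit_closure_map _ _ _ _ (rotate_snd e)).
  exact: circle_action_continuous_r circle_action_rotate_snd.
by move=> p; rewrite skew_rotate_snd.
Qed.

End RotateSecond.

Lemma convex_poly_neq0 (K : nzRingType) (a b : K) j :
  (1 - a) *: (1 : {poly K}) + a *: ((1 - b) *: 'X^j + b *: 'X^(j.+1)) != 0.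
Proof.
apply/eqP => q0; have := congr1 (horner^~ 1) q0.
rewrite -polyC1 !(hornerD, hornerZ, hornerXn, hornerC) !expr1n !mulr1 subrK mulr1 subrK.
by move/eqP; rewrite oner_eq0.
Qed.

Section LinearPhase.
Variables (R : realType) (X : normedModType R[i]) (T : X -> X).
Hypotheses (Tl : linear T) (Tc : continuous T).

Lemma hypercyclic_poly_act (q : {poly R[i]}) x : q != 0 ->
  hypercyclic T x -> hypercyclic T (poly_act T q x).
Proof.
move=> q0 /hypercyclic_circle xh.
by apply: leon_muller => //; exact: poly_act_circle_hypercyclic.
Qed.

(** [circle_extension] applies to the product of [T] with the multiplication by
    [zeta]. The function [g y := h (y, 1)] satisfies
    [g (T y) = zeta ^- m * g y], and the conclusion amounts to [zeta ^+ m = 1].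
    The polynomials that are convex combinations of powers form a convex set
    without 0, on which the argument of [g] has a continuous determination that
    vanishes at [x]. As [g (T y) / g y] is constant, the argument grows by the same
    amount [delta] from [x] to [T x], from [T x] to [T^2 x], and so on, so it is
    [n delta] at [T^n x]. When [T^n x] is close to [x], so is the whole segment
    between them, and [n delta] has to be small. Hence [delta] is small, and
    [zeta ^- m = expi delta] is as close to 1 as desired. *)
Lemma linear_phase x (zeta : R[i]) : hypercyclic T x -> circle zeta ->
  orbit_closure (skew T (fun=> zeta)) (x, 1) (x, zeta).
Proof.
move=> xh zT.
pose S := skew T (fun=> zeta).
pose F := [set poly_act T q x | q in [set q : {poly R[i]} | q != 0]].
pose E : set (X * R[i]) := F `*` @circle R.
have FT y : F y -> F (T y).
  move=> [q /= q0 <-]; exists ('X * q); last exact: poly_actMX.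
  by rewrite /= mulf_neq0// polyX_eq0.
have Fh y : F y -> hypercyclic T y.
  by move=> [q q0 <-]; exact: hypercyclic_poly_act.
have Fx : F x by exists 1; [exact: oner_neq0|exact: poly_act1].
have Sc : continuous S by apply: skew_continuous => //; exact: continuous_const.
have ext := @circle_extension R (X * R[i])%type S (@rotate_snd R X) E Sc.
have {}ext := ext (@circle_action_rotate_snd R X) (skew_rotate_snd T _).
have [c [y d] cT [yF dT]|[y c] [y' c'] [/= Fy cT] [/= Fy' c'T]|] := ext.
- by split => //=; exact: circleM.
- have [c'' c''T cc''] := skew_orbit_closure (u := fun=> zeta) (fun=> zT) cT (Fh _ Fy y').
  exists (c'' / c'); first by apply: circleM => //; exact: circleV.
  by rewrite /rotate_snd /= divfK// circle_neq0.
move=> m [h [hT hc hrot hlead]].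
pose g y := h (y, 1).
have F1 y : F y -> E (y, 1) by move=> ?; split => //=; exact: circle1.
have gT y : F y -> circle (g y) by move=> /F1/hT.
have gn0 y : F y -> g y != 0 by move=> /gT/circle_neq0.
have hE y c : F y -> circle c -> h (y, c) = c ^+ m * g y.
  move=> Fy cT; rewrite -(hrot c (y, 1))//; last exact: F1.
  by rewrite /rotate_snd /= mulr1.
have zm0 : zeta ^+ m != 0 by exact/expf_neq0/circle_neq0.
have gTE y : F y -> g (T y) = (zeta ^+ m)^-1 * g y.
  move=> Fy; apply: (mulfI zm0); rewrite mulVKf// -hE//; last exact: FT.
  apply/esym/hlead; [exact: F1|by split => //=; exact: FT|].
  have := @orbit_closure_iter _ S 1%N (y, 1); by rewrite /= /S /skew /= mulr1.
suff zm1 : zeta ^+ m = 1.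
  apply/hlead; [exact: F1|by []|].
  by rewrite hE// zm1 mul1r.
apply: contrapT => /eqP zm1.
have gc : forall (W : topologicalType) (f : W -> X), continuous f ->
    (forall w, F (f w)) -> continuous (fun w => g (f w)).
  move=> W f fc fF.
  have fc1 : continuous (fun w => (f w, 1 : R[i])).
    by apply: continuous_pair => //; exact: continuous_const.
  exact: (@within_continuous_comp W _ _ E h _ hc fc1 (fun w => F1 _ (fF w))).
(* No angle smaller than kap gives the phase zeta ^- m, which delta should give. *)
have [kap [kap0 kap1 kapP]] : exists kap : R, [/\ 0 < kap, kap <= 1 &
    forall d, `|d| < kap -> expi d != (zeta ^+ m)^-1].
  have ne : `|(zeta ^+ m)^-1 - 1| > 0.
    by rewrite normr_gt0 subr_eq0 invr_eq1.
  have /cvgrPdist_lt/(_ _ ne)/nbhs_ballP[e /= e0 eP] := @continuous_expi R 0.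
  exists (Num.min e 1); split; first by rewrite lt_min e0 ltr01.
    by rewrite ge_min lexx orbT.
  move=> d; rewrite lt_min => /andP[de _]; apply/eqP => dz.
  have := eP d; rewrite /ball /= sub0r normrN dz expi0 distrC ltxx => /(_ de); done.
pose eta : R[i] := `|expi kap - 1|.
have eta0 : 0 < eta.
  rewrite normr_gt0 subr_eq0; apply: expi_eq1 => //; apply: le_lt_trans kap1 _.
  by have := pi_ge2 R; rewrite mulr2n; lra.
have etaN : `|expi (- kap) - 1| = eta.
  have -> : expi (- kap) - 1 = - (expi (- kap) * (expi kap - 1)) :> R[i].
    by rewrite mulrBr expiN mulr1 opprB.
  by rewrite normrN normrM norm_expi mul1r.
(* A return to x which is so close that g stays within eta of g x; with this eta,
   an angle moving away from 0 cannot reach kap or - kap. *)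
have [e e0 near_x] : exists2 e : R[i], 0 < e &
    forall y, F y -> `|x - y| < e -> `|g y - g x| < eta.
  have /cvgrPdist_lt/(_ _ eta0) := hc _ (F1 _ Fx).
  move=> [[U V] /= [Ux V1] UV].
  have /nbhs_ballP[e /= e0 eU] := Ux.
  exists e => // y Fy xy; rewrite distrC; apply: (UV (y, 1)); last exact: F1.
  by split; [apply: eU; rewrite -ball_normE|exact: nbhs_singleton V1].
have [n xn] : exists n, `|x - iter n.+1 T x| < e.
  have /closure_normP/(_ e e0)[_ [n _ <-] xn] := Fh _ (FT _ Fx) x.
  by exists n; rewrite iterSr.
(* Clamping the parameters makes the paths total. For s in [0, 1] the inner
   combination runs from T^j x to T^(j+1) x, and for t in [0, 1] the outer one joins
   x to it. *)
pose cl (t : R) := Num.min 1 (Num.max 0 t) : R.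
have clE t : t \in `[0, 1] -> cl t = t.
  by rewrite in_itv /= => /andP[t0 t1]; rewrite /cl max_r// min_r.
have clc : continuous cl.
  move=> t; apply: (@continuous_min R R); first exact: cvg_cst.
  by apply: continuous_max; [exact: cvg_cst|exact: cvg_id].
pose mix (t : R) (y z : X) : X := (1 - cl t)%:C *: y + (cl t)%:C *: z.
pose V j t s := mix t x (mix s (iter j T x) (iter j.+1 T x)).
have mixc (W : topologicalType) (f : W -> R) (y z : W -> X) : continuous f ->
    continuous y -> continuous z -> continuous (fun w => mix (f w) (y w) (z w)).
  move=> fc yc zc; have cfc := continuous_compose fc clc.
  apply: continuous_add; apply: continuous_scale => //.
    apply: continuous_compose (@real_complex_continuous R).
    by move=> w; apply: cvgB; [exact: cvg_cst|exact: cfc].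
  exact: continuous_compose cfc (@real_complex_continuous R).
have Vc j : continuous (fun p : R * R => V j p.1 p.2).
  apply: (mixc _ _ _ _); [exact: continuous_fst|exact: continuous_const|].
  by apply: (mixc _ _ _ _); [exact: continuous_snd|exact: continuous_const|exact: continuous_const].
have FV j t s : F (V j t s).
  exists ((1 - (cl t)%:C) *: 1 + (cl t)%:C *: ((1 - (cl s)%:C) *: 'X^j + (cl s)%:C *: 'X^(j.+1))).
    exact: convex_poly_neq0.
  by rewrite /V /mix !rmorphB !(poly_actD, poly_actZ) !poly_actXn poly_act1.
have /choice[psi psiP] : forall j, exists psi : R -> R -> R,
    [/\ forall t s, t \in `[0, 1] -> s \in `[0, 1] ->
          g (V j t s) = g (V j 0 s) * expi (psi t s),
      forall s, psi 0 s = 0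
    & forall t s, t \in `[0, 1] -> s \in `[0, 1] ->
        {for (t, s), continuous (fun p : R * R => psi p.1 p.2)}].
  move=> j; apply: (@circle_homotopy_lift R (fun t s => g (V j t s))).
    by apply: gc => // -[t s]; exact: FV.
  by move=> t s; exact/gT/FV.
have i0 : (0 : R) \in `[0, 1] := in01 (lexx _) ler01.
have i1 : (1 : R) \in `[0, 1] := in01 ler01 (lexx _).
have cl0 := clE _ i0; have cl1 := clE _ i1.
have mix0 y z : mix 0 y z = y by rewrite /mix cl0 subr0 scale1r scale0r addr0.
have mix1 y z : mix 1 y z = z by rewrite /mix cl1 subrr scale0r add0r scale1r.
have psiE j t s : t \in `[0, 1] -> s \in `[0, 1] -> expi (psi j t s) = g (V j t s) / g x.
  move=> t01 s01; have [-> // _ _] := psiP j.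
  by rewrite {1}/V mix0 mulrAC divff ?mul1r// gn0.
have psi0 j s : psi j 0 s = 0 by have [] := psiP j.
have psicl j s : s \in `[0, 1] -> {in `[0, 1], forall t, {for t, continuous (psi j ^~ s)}}.
  by move=> s01; have [_ _ c] := psiP j; exact: (lift_slice s01 c).1.
have psicr j : {in `[0, 1], forall t, {for t, continuous (psi j 1)}}.
  by have [_ _ c] := psiP j; exact: (lift_slice i1 c).2.
(* The argument of g at T^j x, followed along the segment from x. *)
pose a j := psi j 1 0.
have aS j : psi j 1 1 = a j.+1.
  have := @expi_lift_unique R (psi j ^~ 1) (psi j.+1 ^~ 0) 1 (psicl j 1 i1) (psicl _ _ i0).
  rewrite !psi0 subrr => H; apply/eqP; rewrite -subr_eq0; apply/eqP/H => t t01.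
  by rewrite mul1r !psiE// /V mix0 mix1.
have a0 : a 0%N = 0.
  have : psi 0%N 1 0 - 0 = psi 0%N 0 0 - 0.
    apply: (@expi_lift_unique R (psi 0%N ^~ 0) (fun=> 0) 1 (psicl 0%N 0 i0)) => t t01.
      exact: cvg_cst.
    rewrite psiE// /V mix0 /= /mix -scalerDl -rmorphD /= subrK scale1r.
    by rewrite divff ?gn0// expi0 mulr1.
  by rewrite psi0 !subr0.
have aD j : a j.+1 - a j = a 1%N.
  elim: j => [|j IH]; first by rewrite a0 subr0.
  rewrite -IH; transitivity (psi j.+1 1 1 - psi j 1 1); first by rewrite !aS.
  apply: (@expi_lift_unique R (psi j.+1 1) (psi j 1) (zeta ^+ m)^-1 (psicr _) (psicr _)).
  move=> t t01; rewrite !psiE// mulrA -gTE; last exact: FV.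
  by rewrite /V !mix1 /mix (linD Tl) !(linZ Tl).
have an j : a j = j%:R * a 1%N.
  elim: j => [|j IH]; first by rewrite mul0r.
  by rewrite -[LHS](subrK (a j)) aD IH -natr1 mulrDl mul1r addrC.
have an_small : `|a n.+1| < kap.
  have far t : t \in `[0, 1] -> `|expi (psi n.+1 t 0) - 1| < eta.
    move=> t01; rewrite psiE//.
    have -> : g (V n.+1 t 0) / g x - 1 = (g (V n.+1 t 0) - g x) / g x.
      by rewrite mulrBl divff// gn0.
    rewrite normrM normfV (circle_norm (gT _ Fx)) invr1 mulr1; apply: near_x; first exact: FV.
    rewrite /V mix0 /mix clE//.
    have -> : x - ((1 - t)%:C *: x + t%:C *: iter n.+1 T x) = t%:C *: (x - iter n.+1 T x).
      by rewrite rmorphB /= scalerBl scale1r scalerBr opprD opprB addrA addrCA subrr addr0.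
    rewrite normrZ; apply: le_lt_trans xn; rewrite ler_piMl//.
    move: t01; rewrite in_itv /= => /andP[t0 t1].
    by rewrite ger0_norm ?lecR ?ler0c.
  have noval v : `|expi v - 1| = eta -> ~ (exists2 t, t \in `[0, 1] & psi n.+1 t 0 = v).
    by move=> ve [t t01 tv]; have := far _ t01; rewrite tv ve ltxx.
  have ivt v : Num.min 0 (a n.+1) <= v <= Num.max 0 (a n.+1) ->
      exists2 t, t \in `[0, 1] & psi n.+1 t 0 = v.
    move=> vv; apply: (@IVT R (psi n.+1 ^~ 0) 0 1 v ler01); last by rewrite psi0.
    by apply: continuous_in_subspaceT => t; rewrite inE; exact: psicl.
  rewrite ltNge; apply/negP; rewrite ler_normr => /orP[ak|ak].
    by apply: (noval kap) => //; apply: ivt; rewrite ge_min le_max ak (ltW kap0) orbT.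
  apply: (noval (- kap)) => //; apply: ivt.
  by rewrite ge_min le_max [a n.+1 <= _]lerNr ak oppr_le0 (ltW kap0) orbT.
have a1_small : `|a 1%N| < kap.
  apply: le_lt_trans an_small; rewrite (an n.+1) normrM normr_nat ler_peMl//.
  by rewrite ler1n.
have := kapP _ a1_small; rewrite psiE// /V mix1 mix0 /= gTE// mulfK ?eqxx//.
exact: gn0.
Qed.
End LinearPhase.

Section LinearPhaseConsequences.
Variables (R : realType) (X : normedModType R[i]) (T : X -> X).
Hypotheses (Tl : linear T) (Tc : continuous T).

Lemma skew_const_continuous (zeta : R[i]) : continuous (skew T (fun=> zeta)).
Proof. by apply: skew_continuous => //; exact: continuous_const. Qed.

Lemma linear_phaseM x (zeta c d : R[i]) :
  orbit_closure (skew T (fun=> zeta)) (x, 1) (x, c) ->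
  orbit_closure (skew T (fun=> zeta)) (x, 1) (x, d) ->
  orbit_closure (skew T (fun=> zeta)) (x, 1) (x, c * d).
Proof.
move=> xc xd; apply: (orbit_closure_trans (@skew_const_continuous _) xc).
by rewrite -[c in (x, c)]mulr1; exact: rotate_orbit_closure.
Qed.

Lemma linear_phaseX x (zeta : R[i]) n : hypercyclic T x -> circle zeta ->
  orbit_closure (skew T (fun=> zeta)) (x, 1) (x, zeta ^+ n).
Proof.
move=> xh zT; elim: n => [|n IH].
  exact: (@orbit_closure_iter _ (skew T (fun=> zeta)) 0%N (x, 1)).
rewrite exprS.
exact: (linear_phaseM (linear_phase Tl Tc xh zT) IH).
Qed.

(** The phases that can be reached form a closed submonoid of the circle that
    contains [zeta], hence all of it. *)
Lemma linear_phase_irrational x (zeta c : R[i]) : hypercyclic T x -> circle zeta ->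
  (forall k, zeta ^+ k = 1 -> k = 0%N) -> circle c ->
  orbit_closure (skew T (fun=> zeta)) (x, 1) (x, c).
Proof.
move=> xh zT zirr cT.
pose H := [set c | circle c /\ orbit_closure (skew T (fun=> zeta)) (x, 1) (x, c)].
have [|||d e [dT xd] [eT xe]|m Hm] := @closed_submonoid_circle R H.
- by move=> d [].
- apply: closedI.
    by apply: compact_closed; [exact: norm_hausdorff|exact: compact_circle].
  apply: closed_comp; last exact: closed_closure.
  by move=> d _; apply: continuous_pair; [exact: continuous_const|exact: continuous_ident].
- by split; [exact: circle1|exact: (@orbit_closure_iter _ (skew T (fun=> zeta)) 0%N (x, 1))].
- by split; [exact: circleM|exact: (linear_phaseM xd xe)].
have m0 : m = 0%N.
  by apply: zirr; apply/(Hm _ zT); split; [exact: zT|exact: (linear_phase Tl Tc xh zT)].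
have /Hm[_] := cT; rewrite m0 expr0 => /(_ erefl)[_]; exact.
Qed.

(** Ansari's theorem. With [zeta] a primitive [q]-th root of 1, [linear_phaseX] gives
    times [n] at which [T^n x] is close to the target and [zeta ^+ n] is close to
    1, which means that [q] divides [n]. *)
Lemma hypercyclic_iter x q : (0 < q)%N -> hypercyclic T x -> hypercyclic (iter q T) x.
Proof.
move=> q0 xh y.
pose zeta : R[i] := expi (pi *+ 2 / q%:R).
have q0' : 0 < q%:R :> R by rewrite ltr0n.
have p0 : 0 < (pi : R) *+ 2 by rewrite mulrn_wgt0 ?pi_gt0.
have zT : circle zeta by exists (pi *+ 2 / q%:R).
have zq : zeta ^+ q = 1 by rewrite -expi_nat mulrC divfK ?expi2pi// gt_eqF.
have zn n : zeta ^+ n = 1 -> (q %| n)%N.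
  rewrite {1}(divn_eq n q) exprD mulnC exprM zq expr1n mul1r => zr.
  apply: contrapT => /negP; rewrite /dvdn -lt0n => r0.
  suff : expi ((n %% q)%:R * (pi *+ 2 / q%:R)) != 1 :> R[i].
    by rewrite expi_nat -/zeta zr eqxx.
  apply: expi_eq1.
    by rewrite mulr_gt0 ?ltr0n// divr_gt0.
  by rewrite mulrCA gtr_pMr// ltr_pdivrMr// mul1r ltr_nat ltn_mod.
clearbody zeta.
suff key n0 : closure (range (fun n => iter n (iter q T) x)) (iter n0 T x).
  apply: (@closed_closure _ _ y); have := xh y; apply: closureS.
  by move=> _ [n _ <-]; exact: key.
have lead : orbit_closure (skew T (fun=> zeta)) (x, 1) (iter n0 T x, 1).
  have e1 : zeta ^+ n0 * zeta ^+ (q.-1 * n0) = 1.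
    by rewrite -exprD -mulSn prednK// exprM zq expr1n.
  have xn0 := @orbit_closure_iter _ (skew T (fun=> zeta)) n0 (x, zeta ^+ (q.-1 * n0)).
  rewrite iter_skew prodr_const card_ord e1 in xn0.
  have xz := @linear_phaseX x zeta (q.-1 * n0)%N xh zT.
  exact: (orbit_closure_trans (@skew_const_continuous zeta) xz xn0).
move=> U Ux.
(* Phi vanishes at the q-th roots of 1 other than 1 itself. *)
pose Phi (c : R[i]) := \sum_(i < q) c ^+ i.
have Phic : continuous Phi.
  apply: continuous_big; first exact: add_continuous.
  by move=> i _; apply: continuous_expn; exact: continuous_ident.
have Phi1 : nbhs (1 : R[i]) [set c | Phi c != 0].
  have : nbhs (Phi 1) (~` [set 0]).
    apply: open_nbhs_nbhs; split.
      exact/closed_openC/accessible_closed_set1/hausdorff_accessible/norm_hausdorff.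
    rewrite /Phi /=; under eq_bigr do rewrite expr1n.
    by rewrite sumr_const card_ord => /eqP; rewrite pnatr_eq0 gtn_eqF.
  move=> /Phic P1; apply: (@filterS _ (nbhs (1 : R[i])) _ _ _ _ P1) => c /=.
  by move=> Pc; apply/eqP.
have [|p [[n _ <-] []]] := lead (U `*` [set c | Phi c != 0]).
  by exists (U, [set c | Phi c != 0]).
rewrite iter_skew /= prodr_const card_ord mulr1 => Un Phin.
have /zn/dvdnP[k nk] : zeta ^+ n = 1.
  apply/eqP; rewrite -subr_eq0; have := subrX1 (zeta ^+ n) q.
  by rewrite -exprM mulnC exprM zq expr1n subrr => /esym/eqP; rewrite mulf_eq0 (negbTE Phin) orbF.
exists (iter n T x); split => //; exists k => //.
by rewrite nk mulnC; elim: k {nk} => [|k IH]; rewrite ?muln0// iterS IH mulnS iterD.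
Qed.
End LinearPhaseConsequences.

(** * Polynomial phases *)

Section Tower.
Variable R : realType.

Definition not_root_of_unity (zeta : R[i]) := forall k, zeta ^+ k = 1 -> k = 0%N.

(** What the extensions built below inherit from hypercyclicity: a point of [E] comes
    back close to [E] at times at which an irrational rotation of the circle is
    close to any prescribed phase. *)
Definition circle_recurrent (Z : topologicalType) (S : Z -> Z) (E : set Z) :=
  forall (zeta sigma : R[i]) z, circle zeta -> not_root_of_unity zeta ->
    circle sigma -> E z ->
    exists2 z', E z' & orbit_closure (skew S (fun=> zeta)) (z, 1) (z', sigma).

Definition circle_cocycle (Z : topologicalType) (S : Z -> Z) (E : set Z) (u : Z -> R[i]) :=
  forall z, E z -> forall n, circle (u (iter n S z)).

Lemma circle_recurrent_skew (Z : topologicalType) (S : Z -> Z) (E : set Z) (u : Z -> R[i]) :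
  continuous S -> continuous u -> circle_cocycle S E u ->
  circle_recurrent S E -> circle_recurrent (skew S u) (E `*` @circle R).
Proof.
move=> Sc uc uT Erec zeta sigma [z c] zT zirr sT [/= Ez cT].
have [z' Ez' zz'] := Erec _ _ _ zT zirr sT Ez.
have vT n : circle (u (iter n (skew S (fun=> zeta)) (z, 1)).1).
  by rewrite iter_skew; exact: uT.
have [c' c'T cc'] := skew_orbit_closure (u := fun p => u p.1) vT cT zz'.
exists (z', c'); first by split.
pose swap (p : Z * R[i] * R[i]) : Z * R[i] * R[i] := ((p.1.1, p.2), p.1.2).
have swapc : continuous swap.
  have f1 := @continuous_fst (Z * R[i])%type R[i].
  apply: continuous_pair; last exact: (continuous_compose f1 (@continuous_snd _ _)).
  apply: continuous_pair; last exact: continuous_snd.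
  exact: (continuous_compose f1 (@continuous_fst _ _)).
have swapS q : swap (skew (skew S (fun=> zeta)) (fun p => u p.1) q) =
    skew (skew S u) (fun=> zeta) (swap q) by reflexivity.
exact: (orbit_closure_map swapc swapS cc').
Qed.

(** This is the step from degree [D] to degree [D + 1], with [u] the phase of degree
    [D]. [circle_extension] applies to the skew product and gives a function
    [h (z, c) = c ^+ m * g z] with [g] continuous on the compact set [E]. Suppose
    [m > 0]. Rotating [z] by a fixed angle [s] multiplies the cocycle at time [n]
    by [expi s ^+ n]. For [s] irrational, [circle_recurrent] gives times [n] at
    which the orbit of [z] is close to some [z'] in [E] and [expi s ^+ n] is close
    to a number [sigma] with [sigma ^+ m = -1]. The invariance of [h] then
    yields [g (s z) / g z = - g (s z') / g z']. This is impossible when [s] is so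
    small that both quotients are close to 1. *)
Lemma skew_transitive (Z : topologicalType) (S : Z -> Z) (rot : R[i] -> Z -> Z)
    (E : set Z) (u : Z -> R[i]) (zeta0 : R) :
  continuous S -> continuous u -> circle_action rot ->
  (forall c z, S (rot c z) = rot c (S z)) ->
  (forall c z, u (rot c z) = c * u z) ->
  compact E -> (forall c z, circle c -> E z -> E (rot c z)) ->
  circle_cocycle S E u ->
  (forall z z', E z -> E z' -> orbit_closure S z z') ->
  circle_recurrent S E -> not_root_of_unity (expi zeta0) ->
  forall p p', (E `*` @circle R) p -> (E `*` @circle R) p' ->
    orbit_closure (skew S u) p p'.
Proof.
move=> Sc uc rotA Srot urot Ec Erot uT Etr Erec irr.
have [rotc rot1 rotM] := rotA.
have S'c : continuous (skew S u) by exact: skew_continuous.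
have dense' p p' : (E `*` @circle R) p -> (E `*` @circle R) p' ->
    exists2 c : R[i], circle c & orbit_closure (skew S u) p (rotate_snd c p').
  move: p p' => [z c] [z' c'] [/= Ez cT] [/= Ez' c'T].
  have [d dT zd] := skew_orbit_closure (uT _ Ez) cT (Etr _ _ Ez Ez').
  exists (d / c'); first by apply: circleM => //; exact: circleV.
  by rewrite /rotate_snd /= divfK// circle_neq0.
have E'rot c p : circle c -> (E `*` @circle R) p -> (E `*` @circle R) (rotate_snd c p).
  by move=> cT [Ep pT]; split => //=; exact: circleM.
have ext := @circle_extension R (Z * R[i])%type (skew S u) (@rotate_snd R Z) (E `*` @circle R) S'c.
have {}ext := ext (@circle_action_rotate_snd R Z) (skew_rotate_snd S _) E'rot dense'.
have [m [h [hT hc hrot hlead]]] := ext.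
move=> p p' Ep Ep'; have [z Ez] : exists z, E z by exists p.1; case: Ep.
suff m0 : m = 0%N.
  apply/(hlead _ _ Ep Ep').
  have [c cT /(hlead _ _ Ep (E'rot _ _ cT Ep')) ->] := dense' _ _ Ep Ep'.
  by rewrite (hrot _ _ cT Ep') m0 expr0 mul1r.
apply: contrapT => /eqP; rewrite -lt0n => m0.
pose g z := h (z, 1).
have E1 z1 : E z1 -> (E `*` @circle R) (z1, 1) by move=> ?; split => //=; exact: circle1.
have E2 z1 d : E z1 -> circle d -> (E `*` @circle R) (z1, d) by [].
have gT z1 : E z1 -> circle (g z1) by move=> /E1/hT.
have hE z1 c : E z1 -> circle c -> h (z1, c) = c ^+ m * g z1.
  move=> Ez1 cT; rewrite -(hrot c (z1, 1) cT (E1 _ Ez1)).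
  by rewrite /rotate_snd /= mulr1.
have small : \forall s \near nbhs (0 : R), E `<=` (fun z1 => E z1 ->
    `|g (rot (expi s) z1) - g z1| < 1).
  move/compact_near_coveringP: Ec; apply => z1 Ez1.
  have half0 : 0 < 2^-1 :> R[i] by rewrite invr_gt0.
  have /cvgrPdist_lt/(_ _ half0) := hc _ (E1 _ Ez1).
  move=> [[U V] /= [Uz V1] UV].
  have gU z2 : U z2 -> E z2 -> `|g z1 - g z2| < 2^-1.
    by move=> Uz2 Ez2; apply: (UV (z2, 1)); [split => //; exact: nbhs_singleton V1|exact: E1].
  have rotU : nbhs (z1, 0 : R) [set p : Z * R | U (rot (expi p.2) p.1)].
    have rc : continuous (fun p : Z * R => rot (expi p.2) p.1).
      apply: (continuous_compose (f := fun p : Z * R => (expi p.2, p.1))) rotc.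
      apply: continuous_pair; last exact: continuous_fst.
      exact: (continuous_compose (@continuous_snd _ _) (@continuous_expi R)).
    by apply: (rc (z1, 0)); rewrite /= expi0 rot1.
  have [[U1 V2] /= [U1z V2s] UV2] := rotU.
  exists (U `&` U1, V2) => /=; first by split => //; exact: filterI.
  move=> [z2 s] /= [[Uz2 U1z2] V2s'] Ez2.
  have Er : E (rot (expi s) z2) by apply: Erot => //; exists s.
  rewrite -(subrKA (g z1)) (splitr 1); apply: le_lt_trans (ler_normD _ _) _.
  rewrite div1r; apply: ltrD; first by rewrite distrC; apply: gU => //; exact: (UV2 (z2, s)).
  exact: gU.
have [s sirr sP] : exists2 s : R, not_root_of_unity (expi s) &
    forall z1, E z1 -> `|g (rot (expi s) z1) - g z1| < 1.
  have /nbhs_ballP[e /= e0 eP] := small.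
  pose N := (Num.truncn (`|zeta0| / e)).+1.
  have N0 : 0 < N%:R :> R by rewrite ltr0n.
  exists (zeta0 / N%:R).
    move=> k k1; apply: irr.
    have -> : zeta0 = N%:R * (zeta0 / N%:R) by rewrite mulrC divfK ?gt_eqF.
    by rewrite expi_nat -exprM mulnC exprM k1 expr1n.
  move=> z1 Ez1; apply: (eP (zeta0 / N%:R)) => //.
  rewrite /ball /= sub0r normrN normrM normfV (gtr0_norm N0).
  rewrite ltr_pdivrMr// mulrC -ltr_pdivrMr//.
  by have /truncn_itv/andP[] : 0 <= `|zeta0| / e by rewrite divr_ge0// ltW.
pose sigma : R[i] := expi (pi / m%:R).
have sigm : sigma ^+ m = -1.
  rewrite -expi_nat mulrC divfK ?pnatr_eq0 -?lt0n//.
  by rewrite /expi cospi sinpi; simpc.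
have sT : circle sigma by exists (pi / m%:R).
have esT : circle (expi s) by exists s.
have [z' Ez' zz'] := Erec _ _ _ esT sirr sT Ez.
have vT n : circle (u (iter n (skew S (fun=> expi s)) (z, 1)).1).
  by rewrite iter_skew; exact: uT.
have [c cT cc] := skew_orbit_closure (u := fun p => u p.1) vT (circle1 R) zz'.
(* Both the orbit of z and that of its rotated copy are images of one orbit, in which
   the middle coordinate records expi s ^+ n. *)
pose A (p : Z * R[i] * R[i]) : Z * R[i] := (p.1.1, p.2).
pose B (p : Z * R[i] * R[i]) : Z * R[i] := (rot (expi s) p.1.1, p.1.2 * p.2).
have f1 := @continuous_fst (Z * R[i])%type R[i].
have f11 := continuous_compose f1 (@continuous_fst _ _).
have Ac : continuous A by apply: continuous_pair => //; exact: continuous_snd.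
have Bc : continuous B.
  apply: continuous_pair.
    exact: (continuous_compose f11 (@circle_action_continuous_r R Z rot (expi s) rotA)).
  apply: continuous_mul; last exact: continuous_snd.
  exact: (continuous_compose f1 (@continuous_snd _ _)).
pose W := skew (skew S (fun=> expi s)) (fun p => u p.1).
have AW q : A (W q) = skew S u (A q) by reflexivity.
have BW q : B (W q) = skew S u (B q).
  by rewrite /B /W /skew /= Srot urot; congr pair; rewrite !mulrA; congr (_ * _); rewrite mulrAC.
have lA := orbit_closure_map Ac AW cc.
have lB := orbit_closure_map Bc BW cc.
rewrite /A /= in lA; rewrite /B /= mulr1 in lB.
have Er z1 : E z1 -> E (rot (expi s) z1) by apply: Erot.
have scT : circle (sigma * c) by exact: circleM.
have hA : g z = c ^+ m * g z'.
  rewrite -(hE _ _ Ez' cT); exact: ((hlead _ _ (E1 _ Ez) (E2 _ _ Ez' cT)).1 lA).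
have hB : g (rot (expi s) z) = - (c ^+ m * g (rot (expi s) z')).
  have -> : - (c ^+ m * g (rot (expi s) z')) = (sigma * c) ^+ m * g (rot (expi s) z').
    by rewrite exprMn sigm mulN1r mulNr.
  rewrite -(hE _ _ (Er _ Ez') scT).
  exact: ((hlead _ _ (E1 _ (Er _ Ez)) (E2 _ _ (Er _ Ez') scT)).1 lB).
have := sP _ Ez; rewrite hA hB -opprD normrN -mulrDr normrM normrX (circle_norm cT) expr1n mul1r.
have -> : g (rot (expi s) z') + g z' = 2 * g z' + (g (rot (expi s) z') - g z').
  by rewrite mulr_natl mulr2n addrCA addrK addrC.
move=> lt1; have : `|2 * g z'| < 2.
  rewrite -[2 * g z'](addrK (g (rot (expi s) z') - g z')) [X in _ < X]mulr2n.
  by apply: le_lt_trans (ler_normB _ _) _; apply: ltrD => //; exact: sP.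
by rewrite normrM (circle_norm (gT _ Ez')) mulr1 normr_nat ltxx.
Qed.
End Tower.

Section PhaseTower.
Variables (R : realType) (X : normedModType R[i]) (T : X -> X).
Hypotheses (Tl : linear T) (Tc : continuous T).

(** An extension [Z] of the operator in which [expi (p n)] is read off by a continuous
    function [u] along the orbit of a point [e] above [x]. Concretely [Z] is [X]
    times a torus, [E] is the torus above [x], and [rot] rotates the last
    coordinate, which is the value of [u]. *)
Inductive phase_tower (x : X) (p : nat -> R) : Prop :=
  PhaseTower (Z : topologicalType) (S : Z -> Z) (u : Z -> R[i])
    (rot : R[i] -> Z -> Z) (pr : Z -> X) (E : set Z) (e : Z) of
    continuous S & continuous u & continuous pr & circle_action rot &
    (forall c z, S (rot c z) = rot c (S z)) &
    (forall c z, u (rot c z) = c * u z) &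
    (forall c z, pr (rot c z) = pr z) &
    (forall z, pr (S z) = T (pr z)) &
    compact E & (forall c z, circle c -> E z -> E (rot c z)) &
    circle_cocycle S E u &
    (forall z z', E z -> E z' -> orbit_closure S z z') &
    circle_recurrent R S E &
    E e & pr e = x & (forall n, u (iter n S e) = expi (p n)).

Lemma circle_recurrent_hypercyclic x : hypercyclic T x -> circle_recurrent R T [set x].
Proof.
move=> xh zeta sigma _ zT zirr sT ->; exists x => //.
exact: (linear_phase_irrational Tl Tc xh zT zirr sT).
Qed.

Lemma phase_tower_linear x (a b : R) : hypercyclic T x -> not_root_of_unity (expi a) ->
  phase_tower x (fun n => n%:R * a + b).
Proof.
move=> xh airr.
have aT : circle (expi a) by exists a.
have Sc := @skew_const_continuous R X T Tc (expi a).
have cc : circle_cocycle T [set x] (fun=> expi a) by [].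
apply: (@PhaseTower _ _ (X * R[i])%type (skew T (fun=> expi a)) (fun p => p.2)
  (@rotate_snd R X) (fun p => p.1) ([set x] `*` @circle R) (x, expi b)) => //.
- exact: continuous_snd.
- exact: continuous_fst.
- exact: circle_action_rotate_snd.
- exact: skew_rotate_snd.
- apply: compact_setX; [exact: compact_set1|exact: compact_circle].
- by move=> c p cT [px pT]; split => //=; exact: circleM.
- move=> [_ c] [/= -> cT] n; rewrite iter_skew /= prodr_const card_ord.
  by apply: circleM => //; exact: circleX.
- move=> [_ c] [_ c'] [/= -> cT] [/= -> c'T].
  have lx := linear_phase_irrational Tl Tc xh aT airr (circleM c'T (circleV cT)).
  have := @rotate_orbit_closure R X T (fun=> expi a) 1 (c' / c) c x x lx.
  by rewrite mulr1 mulrC divfK// circle_neq0.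
- exact: (circle_recurrent_skew Tc (@continuous_const _ _ _) cc (circle_recurrent_hypercyclic xh)).
- by split => //=; exists b.
- by move=> n; rewrite iter_skew /= prodr_const card_ord expiD expi_nat.
Qed.

(** The skew product by the cocycle [u] adds up the phases [q]. *)
Lemma phase_tower_sum x (p q : nat -> R) (a : R) : not_root_of_unity (expi a) ->
  (forall n, p n.+1 = p n + q n) -> phase_tower x q -> phase_tower x p.
Proof.
move=> airr pq [Z S u rot pr E e Sc uc prc rotA Srot urot prot prS Ec Erot uT Etr Erec Ee pre ue].
apply: (@PhaseTower _ _ (Z * R[i])%type (skew S u) (fun p => p.2)
  (@rotate_snd R Z) (fun p => pr p.1) (E `*` @circle R) (e, expi (p 0%N))).
- exact: skew_continuous.
- exact: continuous_snd.
- exact: (continuous_compose (@continuous_fst _ _) prc).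
- exact: circle_action_rotate_snd.
- exact: skew_rotate_snd.
- by [].
- by [].
- by move=> z; rewrite prS.
- by apply: compact_setX => //; exact: compact_circle.
- by move=> c z cT [pz zT]; split => //=; exact: circleM.
- move=> [z c] [/= Ez cT] n; rewrite iter_skew /=; apply: circleM => //.
  elim: n => [|n IH]; first by rewrite big_ord0; exact: circle1.
  by rewrite big_ord_recr; apply: circleM => //; exact: uT.
- exact: (skew_transitive Sc uc rotA Srot urot Ec Erot uT Etr Erec airr).
- exact: (circle_recurrent_skew Sc uc uT Erec).
- by split => //=; exists (p 0%N).
- by [].
- move=> n; rewrite iter_skew /=; elim: n => [|n IH]; first by rewrite big_ord0 mul1r.
  by rewrite big_ord_recr /= mulrAC IH ue pq expiD.
Qed.

(** Since any two points of [E] are in the orbit closure of each other, the orbit of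
    [e] approaches the point of [E] which is rotated so that its phase at time [k]
    is 1; the image of that point at time [k] lies above [iter k T x]. *)
Lemma phase_tower_dense x p : hypercyclic T x -> phase_tower x p ->
  forall y, closure (range (fun n => expi (p n) *: iter n T x)) y.
Proof.
move=> xh [Z S u rot pr E e Sc uc prc rotA Srot urot prot prS Ec Erot uT Etr Erec Ee pre ue] y.
have prn n : pr (iter n S e) = iter n T x by elim: n => //= n IH; rewrite prS IH.
suff key k : closure (range (fun n => expi (p n) *: iter n T x)) (iter k T x).
  by apply: (@closed_closure _ _ y); have := xh y; apply: closureS => _ [n _ <-]; exact: key.
pose e' := rot (expi (- p k)) e.
have Ee' : E e' by apply: Erot => //; exists (- p k).
have lead := orbit_closure_trans Sc (Etr _ _ Ee Ee') (@orbit_closure_iter _ S k e').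
have Fc : continuous (fun z => u z *: pr z) by exact: continuous_scale.
have := closure_image (Fc _) lead.
have Srotn n : iter n S e' = rot (expi (- p k)) (iter n S e).
  by elim: n => //= n ->; rewrite Srot.
rewrite Srotn urot prot prn ue expiN scale1r; apply: closureS.
by move=> _ [_ [n _ <-] <-]; exists n; rewrite // ue prn.
Qed.

(** The forward difference [P(X + 1) - P(X)], expanded by Taylor's formula so that its
    degree and leading coefficient can be read off. *)
Definition poly_diff (P : {poly R}) : {poly R} :=
  \sum_(i < (size P).-1) P^`N(i.+1).

Lemma poly_diffE P t : P.[t + 1] = P.[t] + (poly_diff P).[t].
Proof.
rewrite nderiv_taylor; last exact: mulrC.
rewrite /poly_diff horner_sum; have [->|P0] := eqVneq P 0.
  by rewrite size_poly0 !big_ord0 horner0 add0r.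
rewrite -[size P]prednK ?lt0n ?size_poly_eq0//= big_ord_recl /= nderivn0 expr0 mulr1.
by congr (_ + _); apply: eq_bigr => i _; rewrite expr1n mulr1.
Qed.

Lemma coef_poly_diff (P : {poly R}) D : (size P <= D.+2)%N ->
  (size (poly_diff P) <= D.+1)%N /\ (poly_diff P)`_D = P`_D.+1 *+ D.+1.
Proof.
move=> sP; split.
  apply/leq_sizeP => j Dj; rewrite coef_sum big1// => i _.
  by rewrite coef_nderivn nth_default ?mul0rn//; apply: leq_trans sP _; lia.
rewrite coef_sum; have [PD|PD] := ltnP 1 (size P).
  rewrite -[(size P).-1]prednK; last by case: (size P) PD => [|[]].
  rewrite big_ord_recl big1 ?addr0 => [|i _].
    by rewrite coef_nderivn add1n bin1.
  by rewrite coef_nderivn nth_default ?mul0rn//; apply: leq_trans sP _; rewrite /= /bump; lia.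
have -> : (size P).-1 = 0%N by case: (size P) PD => [|[]].
by rewrite big_ord0 nth_default ?mul0rn//; apply: leq_trans PD _.
Qed.

Lemma phase_tower_poly x D : hypercyclic T x -> forall P : {poly R},
  (size P <= D.+2)%N -> not_root_of_unity (expi P`_D.+1) ->
  phase_tower x (fun n => P.[n%:R]).
Proof.
move=> xh; elim: D => [|D IH] P sP irr.
  have PE : (fun n : nat => P.[n%:R]) = (fun n => n%:R * P`_1 + P`_0).
    apply/funext => n; rewrite (horner_coef_wide _ sP) !big_ord_recl big_ord0.
    by rewrite expr0 expr1 mulr1 addr0 addrC mulrC.
  by rewrite PE; exact: phase_tower_linear.
have [sQ cQ] := coef_poly_diff sP.
apply: (phase_tower_sum irr (q := fun n => (poly_diff P).[n%:R])).
  by move=> n; rewrite -natr1 poly_diffE.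
apply: IH => //; rewrite cQ => k; rewrite -mulr_natl expi_nat -exprM => /irr/eqP.
by rewrite muln_eq0 => /eqP.
Qed.

End PhaseTower.

Section PolynomialPhases.
Variables (R : realType) (X : normedModType R[i]).

(** Induction on the degree. If the leading coefficient is an irrational multiple of
    [2 pi], a phase tower does it. Otherwise [k] times this coefficient is a
    multiple of [2 pi] for some [k > 0]; at the times divisible by [k] the leading
    term has no effect, and one is left with a polynomial of smaller degree and
    with [iter k T], which still has [x] as a hypercyclic vector. *)
Lemma poly_phase_dense D (T : X -> X) x (P : {poly R}) : linear T -> continuous T ->
  hypercyclic T x -> (size P <= D.+1)%N ->
  forall y, closure (range (fun n => expi P.[n%:R] *: iter n T x)) y.
Proof.
elim: D T x P => [|D IH] T x P Tl Tc xh sP y.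
  have PE n : P.[n%:R] = P`_0.
    by rewrite (horner_coef_wide _ sP) big_ord1 expr0 mulr1.
  pose c : R[i] := expi P`_0.
  have cT : circle c by exists P`_0.
  have sc : continuous (fun z : X => c *: z) by exact: scaler_continuous.
  have := closure_image (sc _) (xh (c^-1 *: y)).
  rewrite scalerA mulfV ?circle_neq0// scale1r; apply: closureS.
  by move=> _ [_ [n _ <-] <-]; exists n; rewrite // PE.
have [irr|/existsNP[k /not_implyP[k1 /eqP k0]]] := pselect (not_root_of_unity (expi P`_D.+1)).
  have tw := phase_tower_poly Tl Tc xh sP irr.
  exact: (@phase_tower_dense R X T x _ xh tw y).
pose a := P`_D.+1.
pose Q := (P - a *: 'X^(D.+1)) \Po (k%:R *: 'X).
have sQ : (size Q <= D.+1)%N.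
  have sPa : (size (P - a *: 'X^(D.+1))%R <= D.+1)%N.
    apply/leq_sizeP => j; rewrite leq_eqVlt => /predU1P[<-|Dj].
      by rewrite coefB coefZ coefXn eqxx mulr1 subrr.
    rewrite coefB coefZ coefXn gtn_eqF// mulr0 subr0.
    by move/leq_sizeP: sP; apply.
  apply: leq_trans (size_comp_poly_leq _ _) _; rewrite ltnS.
  have sX : ((size (k%:R *: 'X : {poly R})%R).-1 <= 1)%N.
    by have := size_scale_leq (k%:R : R) 'X; rewrite size_polyX; case: (size _) => [|[|[|n]]].
  apply: leq_trans (leq_mul (leqnn _) sX) _; rewrite muln1.
  by move: sPa; case: (size _).
(* The removed term is n ^ D.+1 * k ^ D times the multiple k * a of 2 pi. *)
have QE n : expi Q.[n%:R] = expi P.[(n * k)%:R].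
  rewrite horner_comp !(hornerD, hornerN, hornerZ, hornerXn, hornerX) -natrM mulnC expiD.
  rewrite -[RHS]mulr1; congr (_ * _).
  have -> : - (a * (n * k)%:R ^+ D.+1) = (n ^ D.+1 * k ^ D)%:R * (k%:R * - a).
    by rewrite !natrM !natrX exprMn [k%:R ^+ D.+1]exprS; ring.
  rewrite expi_nat mulrN; have -> : expi (- (k%:R * a)) = 1 :> R[i].
    by have := expiN (k%:R * a); rewrite expi_nat k1 mulr1.
  by rewrite expr1n.
have k_gt0 : (0 < k)%N by rewrite lt0n.
have := IH (iter k T) x Q (linear_iter k Tl) (continuous_iter Tc)
  (hypercyclic_iter Tl Tc k_gt0 xh) sQ y.
apply: closureS => _ [n _ <-]; exists (n * k)%N => //; rewrite QE; congr (_ *: _).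
by elim: n => //= n IHn; rewrite mulSn iterD IHn.
Qed.

Lemma ultra_circle_limit (G : set_system nat) (w : nat -> R[i]) : UltraFilter G ->
  (forall n, circle (w n)) -> exists t : R, w n @[n --> G] --> expi t.
Proof.
move=> GU wT.
have [|c [[t _ tc] cG]] := @compact_circle R (w n @[n --> G]) _.
  by apply: (@filterS _ G _ setT) => [n _|]; [exact: wT|exact: filterT].
exists t; rewrite tc => V Vc.
have [//|GV] := in_ultra_setVsetC (w @^-1` V) GU.
by have [z [nVz Vz]] := cG (~` V) V GV Vc; case: nVz.
Qed.

Lemma expi_sum n (F : nat -> R) :
  expi (\sum_(i < n) F i) = \prod_(i < n) expi (F i) :> R[i].
Proof.
elim: n => [|n IH]; first by rewrite !big_ord0 expi0.
by rewrite !big_ord_recr /= expiD IH.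
Qed.

(** Along an ultrafilter of times [n] tending to infinity with [T^n x] tending to
    [x], the phases of [f n] and of all [g l n] converge. As [k ^ l] is an
    integer, the phase of [g l n * k ^ l] converges too, and the phase of
    [f (n + k)] tends to that of a polynomial in [k]. *)
Lemma polynomial_limit_orbit (T : X -> X) x (f : nat -> R) d (g eps : nat -> nat -> R) :
  linear T -> continuous T -> hypercyclic T x ->
  (forall n k : nat, (1 <= n)%N -> (1 <= k)%N ->
     f (n + k)%N - f n = \sum_(0 <= l < d.+1) g l n * k%:R ^+ l + eps k n) ->
  (forall k : nat, (1 <= k)%N -> `|eps k n| @[n --> \oo] --> (0 : R)) ->
  exists P : {poly R}, forall k, (1 <= k)%N ->
    closure [set expi (f n) *: iter n T x | n in [set n : nat | (1 <= n)%N]]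
      (expi P.[k%:R] *: iter k T x).
Proof.
move=> Tl Tc xh fg eps0.
pose F (A : set nat) := exists N U, nbhs x U /\
  forall n, (N <= n)%N -> U (iter n T x) -> A n.
have FF : ProperFilter F.
  split.
    move=> [N [U [Ux UN]]].
    have xNh : hypercyclic T (iter N T x).
      by rewrite -(poly_actXn T); apply: hypercyclic_poly_act; rewrite // monic_neq0 ?monicXn.
    have [_ [[n _ <-] Un]] := xNh x U Ux.
    by apply: (UN (n + N)%N); rewrite ?leq_addl// iterD.
  split.
  - by exists 0%N, setT; split => //; exact: filterT.
  - move=> A B [N [U [Ux UA]]] [M [V [Vx VB]]].
    exists (maxn N M), (U `&` V); split; first exact: filterI.
    by move=> n; rewrite geq_max => /andP[Nn Mn] [Un Vn]; split; [exact: UA|exact: VB].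
  - by move=> A B AB [N [U [Ux UA]]]; exists N, U; split => // n Nn /(UA n Nn)/AB.
have [G [GU FG]] := ultraFilterLemma FF.
have Goo (A : set nat) : (\forall n \near \oo, A n) -> G A.
  by move=> [N _ NA]; apply: FG; exists N, setT; split; [exact: filterT|move=> n Nn _; exact: NA].
have Gx : iter n T x @[n --> G] --> x.
  by move=> U Ux; apply: FG; exists 0%N, U.
have [c0 fc] := ultra_circle_limit GU (w := fun n => expi (f n)) (fun n => imageT _ _).
have /choice[th gth] : forall l, exists t, expi (g l n) @[n --> G] --> (expi t : R[i]).
  by move=> l; apply: (ultra_circle_limit GU) => n; exists (g l n).
exists (c0%:P + \sum_(l < d.+1) th l *: 'X^l) => k k1.
have phase : expi (f (n + k)%N) @[n --> G] -->
    (expi (c0%:P + \sum_(l < d.+1) th l *: 'X^l).[k%:R] : R[i]).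
  have -> : expi (c0%:P + \sum_(l < d.+1) th l *: 'X^l).[k%:R] =
      expi c0 * \prod_(l < d.+1) (expi (th l) ^+ (k ^ l)) * expi 0 :> R[i].
    rewrite hornerD hornerC horner_sum expiD expi0 mulr1; congr (_ * _).
    rewrite (expi_sum _ (fun l => (th l *: 'X^l).[k%:R])); apply: eq_bigr => l _.
    by rewrite hornerZ hornerXn -natrX mulrC expi_nat.
  apply: (@cvg_trans _ (expi (f n) *
      \prod_(l < d.+1) (expi (g l n) ^+ (k ^ l)) * expi (eps k n) @[n --> G])).
    apply: near_eq_cvg; apply: Goo; exists 1%N => // n n1 /=.
    have -> : f (n + k)%N = f n + (\sum_(0 <= l < d.+1) g l n * k%:R ^+ l + eps k n).
      by rewrite -fg// addrC subrK.
    rewrite big_mkord addrA !expiD; congr (_ * _ * _).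
    rewrite (expi_sum _ (fun l => g l n * k%:R ^+ l)); apply: eq_bigr => l _.
    by rewrite -natrX mulrC expi_nat.
  have lim1 : \prod_(l < d.+1) (expi (g l n) ^+ (k ^ l)) @[n --> G] -->
      (\prod_(l < d.+1) (expi (th l) ^+ (k ^ l)) : R[i]).
    apply: cvg_big => [|l _]; first exact: mul_continuous.
    have ec : continuous (fun c : R[i] => c ^+ (k ^ l)).
      by apply: continuous_expn; exact: continuous_ident.
    exact: (cvg_comp _ _ (gth l) (ec _)).
  have eps0' : eps k n @[n --> G] --> (0 : R).
    by move=> U /(norm_cvg0 (eps0 k k1)); exact: Goo.
  have lim2 : expi (eps k n) @[n --> G] --> (expi 0 : R[i]).
    exact: (cvg_comp _ _ eps0' (@continuous_expi R 0)).
  exact: (cvgM (cvgM fc lim1) lim2).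
have Tk : iter (n + k) T x @[n --> G] --> iter k T x.
  have -> : (fun n => iter (n + k) T x) = (fun n => iter k T (iter n T x)).
    by apply/funext => n; rewrite addnC iterD.
  exact: (cvg_comp _ _ Gx (@continuous_iter _ T k Tc x)).
move=> U /(cvgZ phase Tk) GU1.
have [n [n1 Un]] : exists n, (1 <= n)%N /\ U (expi (f (n + k)%N) *: iter (n + k) T x).
  have G1 : G [set n | (1 <= n)%N] by apply: Goo; exists 1%N.
  have GU2 : G [set n | U (expi (f (n + k)%N) *: iter (n + k) T x)] := GU1.
  by have [n [n1 Un]] := filter_ex (filterI G1 GU2); exists n.
by exists (expi (f (n + k)%N) *: iter (n + k) T x); split => //; exists (n + k)%N => //=; lia.
Qed.
End PolynomialPhases.

(** * Asymptotically polynomial phases *)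

Lemma bounded_operator_continuous (R : realType) (X : normedModType R[i])
  (T : X -> X) : linear T -> bounded_operator T -> continuous T.
Proof.
move=> Tl [M TM] y; apply/(@cvgrPdist_lt _ _ _ (nbhs y)) => e e0.
have M1 : 0 < (`|M| + 1)%:C :> R[i] by rewrite ltcR ltr_wpDl.
have /cvgrPdist_lt/(_ _ (divr_gt0 e0 M1)) := @cvg_id _ (nbhs y).
apply: filterS => z yz; rewrite -(linB Tl).
apply: le_lt_trans (TM _) _; rewrite ltr_pdivlMr// mulrC in yz.
apply: le_lt_trans yz; apply: ler_wpM2r => //.
by rewrite lecR (le_trans (ler_norm M))// lerDl.
Qed.

Lemma dense_closureP (T : topologicalType) (A : set T) :
  dense A <-> forall y, closure A y.
Proof.
split=> [dA y U|cA U [y Uy] Uo].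
  rewrite nbhsE => -[V [Vo Vy] VU].
  have [z [Vz Az]] := dA V (ex_intro _ y Vy) Vo.
  by exists z; split => //; exact: VU.
have [z [Az Uz]] := cA y U (open_nbhs_nbhs (conj Uo Uy)).
by exists z.
Qed.

Theorem theorem4p3 (R : realType) (X : completeNormedModType R[i])
    (T : {linear X -> X}) (T_bounded : bounded_operator T)
    (x : X) (f : nat -> R)
    (f_condition :
      exists (d : nat) (g : nat -> nat -> R) (eps : nat -> nat -> R),
        (forall n k : nat, (1 <= n)%N -> (1 <= k)%N ->
           f (n + k)%N - f n
             = \sum_(0 <= l < d.+1) g l n * k%:R ^+ l + eps k n) /\
        (forall k : nat, (1 <= k)%N ->
           `|eps k n| @[n --> \oo] --> (0 : R))) :
  HC T x <->
  dense [set expi (f n) *: iter n T x | n in [set n : nat | (1 <= n)%N]].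
Proof.
have Tl : linear T := linearP T.
have Tc := bounded_operator_continuous Tl T_bounded.
have HCE : HC T x <-> hypercyclic T x by exact: dense_closureP.
rewrite HCE dense_closureP; split=> [xh y|xd]; last first.
  apply: leon_muller => // y; have := xd y; apply: closureS.
  by move=> _ [n _ <-]; exists (f n, n).
have [d [g [eps [fg eps0]]]] := f_condition.
have [P PT] := polynomial_limit_orbit Tl Tc xh fg eps0.
have Txh : hypercyclic T (T x).
  by rewrite -[T x](poly_actXn T 1); apply: hypercyclic_poly_act; rewrite ?expr1 ?polyX_eq0.
apply: (@closed_closure _ _ y).
(* The polynomial P describes the closure only at times k >= 1, hence the shift by 1. *)
have := @poly_phase_dense R X (size P) T (T x) (P \Po ('X + 1%:P)) Tl Tc Txh _ y.
have sQ : (size (P \Po ('X + 1%:P))%R <= (size P).+1)%N.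
  apply: leq_trans (size_comp_poly_leq _ _) _.
  by rewrite size_XaddC muln1 ltnS leq_pred.
move=> /(_ sQ); apply: closureS => _ [n _ <-].
have := PT n.+1 isT; rewrite iterSr horner_comp !hornerE.
by rewrite -natr1.
Qed.
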